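(* Let $C_6\approx7.8631112181$ be the largest root of the polynomial $$6967296x^{20}+2015974656x^{18}-160813808784x^{16}+603818269839x^{14}-894980577861x^{12}$$ $$+677249814873x^{10}-274035844587x^8+60418557684x^6-6782842860x^4+290960784x^2+7744.$$ For every triangle, the following bounds hold, where a bound $L\le \frac{D(n,i)}{D(n,j)}\le U$ means $L\,D(n,j)\le D(n,i)\le U\,D(n,j)$ (and similarly for one-sided bounds): $$\frac{D(6,1)}{D(6,2)}\le9-6\sqrt2,\quad \frac{D(6,1)}{D(6,3)}\le2-\sqrt3,\quad \frac12\le\frac{D(6,1)}{D(6,7)},\quad \frac{D(6,1)}{D(6,8)}\le\frac{2\sqrt2-1}7,\quad \frac{D(6,1)}{D(6,9)}\le\frac13,\quad \frac{D(6,1)}{D(6,10)}\le\sqrt2-1,$$ $$\frac{D(6,2)}{D(6,3)}\le\frac23,\quad 1\le\frac{D(6,2)}{D(6,7)},\quad \frac13\le\frac{D(6,2)}{D(6,8)}\le\frac{5+4\sqrt2}{21},\quad \frac12\le\frac{D(6,2)}{D(6,9)}\le\frac34,\quad \frac23\le\frac{D(6,2)}{D(6,10)}\le\frac{1+\sqrt2}3,$$ $$\frac12\le\frac{D(6,3)}{D(6,4)},\quad 2\le\frac{D(6,3)}{D(6,5)},\quad C_6\le\frac{D(6,3)}{D(6,7)},\quad \frac12\le\frac{D(6,3)}{D(6,8)},\quad 1\le\frac{D(6,3)}{D(6,9)},\quad 1\le\frac{D(6,3)}{D(6,10)},$$ $$\frac{D(6,7)}{D(6,8)}\le\frac12,\quad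 \frac{D(6,7)}{D(6,9)}\le\frac12,\quad \frac{D(6,7)}{D(6,10)}\le\frac45,\quad 1\le\frac{D(6,8)}{D(6,9)}\le2,\quad 3-\sqrt2\le\frac{D(6,8)}{D(6,10)}\le2,\quad 1\le\frac{D(6,9)}{D(6,10)}\le\frac85.$$
   Context: For a (nondegenerate) triangle $ABC$ with side lengths $a=BC$, $b=CA$, $c=AB$, a point with barycentric coordinates $(u:v:w)$ is $(uA+vB+wC)/(u+v+w)$. For $1\le n\le 10$ the triangle center $X_n$ is the point with barycentric coordinates $(f_n(a,b,c):f_n(b,c,a):f_n(c,a,b))$, where $f_1=a$ (incenter); $f_2=1$ (centroid); $f_3=a^2(a^2-b^2-c^2)$ (circumcenter); $f_4=(a^2+b^2-c^2)(a^2-b^2+c^2)$ (orthocenter); $f_5=c^4-a^2b^2+b^4-a^2c^2-2b^2c^2$ (nine-point center); $f_6=a^2$ (symmedian point); $f_7=(a+b-c)(a-b+c)$ (Gergonne point); $f_8=a-b-c$ (Nagel point); $f_9=a(a-b-c)$ (mittenpunkt); $f_{10}=b+c$ (Spieker center). $D(i,j)$ denotes the Euclidean distance between $X_i$ and $X_j$. Roots of polynomials are real roots. *)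

(* Defs.v *)
From Stdlib Require Import Reals.

Local Open Scope R_scope.

Definition point : Type := (R * R)%type.

Definition point_dist (P Q : point) : R := dist_euc (fst P) (snd P) (fst Q) (snd Q).

(* The left-hand side is twice the signed area of ABC. *)
Definition nondegenerate (A B C : point) : Prop :=
  (fst B - fst A) * (snd C - snd A) - (snd B - snd A) * (fst C - fst A) <> 0.

Definition barycentric (A B C : point) (u v w : R) : point :=
  ((u * fst A + v * fst B + w * fst C) / (u + v + w),
   (u * snd A + v * snd B + w * snd C) / (u + v + w)).

(* First barycentric coordinate of the n-th triangle center as a function of
   the side lengths; 0 is a junk value for n outside 1..10. *)
Definition center_function (n : nat) (a b c : R) : R :=
  match n with
  | 1%nat => a                                         (* incenter *)
  | 2%nat => 1                                         (* centroid *)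
  | 3%nat => a^2 * (a^2 - b^2 - c^2)                   (* circumcenter *)
  | 4%nat => (a^2 + b^2 - c^2) * (a^2 - b^2 + c^2)     (* orthocenter *)
  | 5%nat => c^4 - a^2 * b^2 + b^4 - a^2 * c^2
             - 2 * b^2 * c^2                           (* nine-point center *)
  | 6%nat => a^2                                       (* symmedian point *)
  | 7%nat => (a + b - c) * (a - b + c)                 (* Gergonne point *)
  | 8%nat => a - b - c                                 (* Nagel point *)
  | 9%nat => a * (a - b - c)                           (* mittenpunkt *)
  | 10%nat => b + c                                    (* Spieker center *)
  | _ => 0
  end.

Definition center (A B C : point) (n : nat) : point :=
  let a := point_dist B C in
  let b := point_dist C A in
  let c := point_dist A B in
  barycentric A B C (center_function n a b c)
                    (center_function n b c a)
                    (center_function n c a b).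

Definition center_dist (A B C : point) (i j : nat) : R :=
  point_dist (center A B C i) (center A B C j).

Definition is_largest_root (p : R -> R) (r : R) : Prop :=
  p r = 0 /\ forall x : R, p x = 0 -> x <= r.

Definition poly_C6 (x : R) : R :=
  6967296 * x^20 + 2015974656 * x^18 - 160813808784 * x^16
  + 603818269839 * x^14 - 894980577861 * x^12 + 677249814873 * x^10
  - 274035844587 * x^8 + 60418557684 * x^6 - 6782842860 * x^4
  + 290960784 * x^2 + 7744.

(* Main.v *)
(* Write a = y + z, b = z + x, c = x + y with x, y, z > 0 and let p, q, r be the
   elementary symmetric functions of x, y, z.  Each D(6,n)^2 is a rational
   function of p, q, r, so that each bound says that a polynomial of degree at
   most 3 in r is nonnegative.  For fixed p and q, the extreme values of r belong
   to isosceles or degenerate triangles, and the Bernstein coefficients in r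
   between them are binary forms in the shape parameters of these triangles.
   These forms have nonnegative coefficients, except for two which are squares
   up to a positive factor: they yield the constants 9 - 6 sqrt 2 and
   2 - sqrt 3.  The points X_1, X_2, X_10, X_8 being collinear, the other bounds
   with sqrt 2 follow from the first of these.

   The quotient D(6,3)/D(6,7) is smallest at a scalene triangle.  In terms of
   q/p^2 and r/(pq) its square is large outside a small rectangle; so it has a
   minimum k inside that rectangle, and eliminating the coordinates from the
   equations of a critical point shows that k is a root of the polynomial P with
   P(x^2) = poly_C6 x.  As P increases on [60, oo) and k >= 60, sqrt k is the
   largest root of poly_C6. *)
Require Import Defs.
From Stdlib Require Import Reals Lra Lia ClassicalEpsilon.
From Coquelicot Require Import Coquelicot.
Local Open Scope R_scope.

(** * Squared distances in terms of symmetric functions *)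

Lemma point_dist_sq (P Q : point) :
  (point_dist P Q)^2 = (fst P - fst Q)^2 + (snd P - snd Q)^2.
Proof.
  unfold point_dist, dist_euc. rewrite pow2_sqrt.
  - unfold Rsqr. ring.
  - apply Rplus_le_le_0_compat; apply Rle_0_sqr.
Qed.

Lemma point_dist_nonneg (P Q : point) : 0 <= point_dist P Q.
Proof. apply sqrt_pos. Qed.

(** By Heron's formula a nonzero area makes the product of the four factors positive; each of the
    last three is then positive. *)
Lemma triangle_ravi (A B C : point) :
  nondegenerate A B C ->
  exists x y z, 0 < x /\ 0 < y /\ 0 < z /\
    point_dist B C = y + z /\ point_dist C A = z + x /\ point_dist A B = x + y.
Proof.
  intros H.
  pose proof (point_dist_nonneg B C) as Ha. pose proof (point_dist_nonneg C A) as Hb.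
  pose proof (point_dist_nonneg A B) as Hc.
  pose proof (point_dist_sq B C) as Ea. pose proof (point_dist_sq C A) as Eb.
  pose proof (point_dist_sq A B) as Ec.
  set (a := point_dist B C) in *. set (b := point_dist C A) in *.
  set (c := point_dist A B) in *.
  (* Heron's formula *)
  assert (Hh : 0 < (a + b + c) * ((b + c - a) * ((c + a - b) * (a + b - c)))).
  { replace ((a + b + c) * ((b + c - a) * ((c + a - b) * (a + b - c))))
      with (2 * a^2 * b^2 + 2 * b^2 * c^2 + 2 * c^2 * a^2
            - (a^2)^2 - (b^2)^2 - (c^2)^2) by ring.
    rewrite Ea, Eb, Ec.
    pose proof (Rsqr_pos_lt _ H) as H2. unfold Rsqr in H2. nra. }
  clearbody a b c. clear Ea Eb Ec H.
  exists ((b + c - a) / 2), ((c + a - b) / 2), ((a + b - c) / 2).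
  assert (Hs : 0 < a + b + c).
  { destruct (Req_dec (a + b + c) 0) as [E | E]; [| lra].
    rewrite E, Rmult_0_l in Hh. lra. }
  assert (Hh' : 0 < (b + c - a) * ((c + a - b) * (a + b - c))) by nra.
  clear Hh.
  (* Two of the three factors add up to twice a side, so if one were nonpositive, the other two
     would be nonnegative and the product nonpositive. *)
  assert (Hpos : forall u v w, 0 <= u + v -> 0 <= u + w -> 0 < u * (v * w) -> 0 < u).
  { intros u v w H1 H2 H3. destruct (Rlt_le_dec 0 u) as [Hu | Hu]; [exact Hu |].
    assert (0 <= v * w) by (apply Rmult_le_pos; lra). nra. }
  pose proof (Hpos (b + c - a) (c + a - b) (a + b - c) ltac:(lra) ltac:(lra) ltac:(lra)).
  pose proof (Hpos (c + a - b) (b + c - a) (a + b - c) ltac:(lra) ltac:(lra) ltac:(lra)).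
  pose proof (Hpos (a + b - c) (b + c - a) (c + a - b) ltac:(lra) ltac:(lra) ltac:(lra)).
  repeat split; lra.
Qed.

(* Coefficient of r^k in the numerator of 4 (p^2 - q)^2 D(6,n)^2. *)
Definition dist_num_coef (n k : nat) (p q : R) : R :=
  match n, k with
  | 1%nat, 0%nat => p^3 * q^2 - 4 * p * q^3
  | 1%nat, 1%nat => 2 * p^2 * q + 4 * q^2
  | 1%nat, 2%nat => - 3 * p
  | 2%nat, 0%nat => 4 * p^6 - 12 * p^4 * q - 15 * p^2 * q^2 - 4 * q^3
  | 2%nat, 1%nat => 48 * p^3 + 6 * p * q
  | 2%nat, 2%nat => - 27
  | 3%nat, 0%nat => p^2 * q^2 * (p^2 - q)^2
  | 3%nat, 1%nat => - 2 * p^5 * q - 8 * p^3 * q^2 - 2 * p * q^3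
  | 3%nat, 2%nat => p^4 + 22 * p^2 * q + q^2
  | 3%nat, 3%nat => - 12 * p
  | 4%nat, 0%nat => p^2 * q^2 * (p^2 - q)^2
  | 4%nat, 1%nat => - 4 * p^7 + 10 * p^5 * q - 11 * p^3 * q^2 + 2 * p * q^3
  | 4%nat, 2%nat => 17 * p^4 - 12 * p^2 * q + q^2
  | 4%nat, 3%nat => - 3 * p
  | 5%nat, 0%nat => p^2 * q^2 * (p^2 - q)^2
  | 5%nat, 1%nat => - 2 * p^5 * q - 44 * p^3 * q^2 - 2 * p * q^3
  | 5%nat, 2%nat => 129 * p^4 - 34 * p^2 * q + q^2
  | 5%nat, 3%nat => - 48 * p
  | 7%nat, 0%nat => p^2 * q^4 - 4 * q^5
  | 7%nat, 1%nat => 6 * p * q^3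
  | 7%nat, 2%nat => - 12 * p^4 + 36 * p^2 * q - 27 * q^2
  | 8%nat, 0%nat => 4 * p^7 - 20 * p^5 * q + 17 * p^3 * q^2 - 4 * p * q^3
  | 8%nat, 1%nat => 40 * p^4 - 50 * p^2 * q + 16 * q^2
  | 8%nat, 2%nat => - 3 * p
  | 9%nat, 0%nat => p^6 * q^2 - 4 * p^4 * q^3
  | 9%nat, 1%nat => 2 * p^5 * q + 4 * p^3 * q^2
  | 9%nat, 2%nat => - 3 * p^4
  | 10%nat, 0%nat => p^7 - 4 * p^5 * q
  | 10%nat, 1%nat => 11 * p^4 - 6 * p^2 * q + q^2
  | 10%nat, 2%nat => - 3 * p
  | _, _ => 0
  end.

Definition dist_num (n : nat) (p q r : R) : R :=
  dist_num_coef n 0 p q + dist_num_coef n 1 p q * r + dist_num_coef n 2 p q * r^2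
  + dist_num_coef n 3 p q * r^3.

(** The denominator of [4 (p^2 - q)^2 D(6,n)^2] without its possible factor r. Splitting this factor
    off keeps the later differences cubic in r. *)
Definition dist_den_coef (n : nat) (p q : R) : R :=
  match n with
  | 2%nat => 9
  | 3%nat => 4 * p
  | 5%nat => 16 * p
  | 7%nat | 9%nat => q^2
  | _ => p
  end.

Definition dist_den_has_r (n : nat) : bool :=
  match n with 3%nat | 4%nat | 5%nat => true | _ => false end.

Definition dist_den (n : nat) (p q r : R) : R :=
  dist_den_coef n p q * if dist_den_has_r n then r else 1.

Lemma dist_den_pos (n : nat) (p q r : R) : 0 < p -> 0 < q -> 0 < r -> 0 < dist_den n p q r.
Proof.
  intros Hp Hq Hr. apply Rmult_lt_0_compat; [| destruct (dist_den_has_r n); lra].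
  do 10 (destruct n as [|n]; [cbn [dist_den_coef]; try apply pow_lt; lra |]).
  cbn [dist_den_coef]. lra.
Qed.

(** Up to the factor [s * s'], the displacement has barycentric coordinates [x, y, z] with sum 0,
    and the squared length of such a vector is [-(a^2 yz + b^2 zx + c^2 xy)]. *)
Lemma barycentric_dist_sq (A B C : point) (u v w u' v' w' : R) :
  let s := u + v + w in let s' := u' + v' + w' in
  s <> 0 -> s' <> 0 ->
  let x := u * s' - u' * s in
  let y := v * s' - v' * s in
  let z := w * s' - w' * s in
  (point_dist (barycentric A B C u v w) (barycentric A B C u' v' w'))^2
    * (s * s')^2
  = - ((point_dist B C)^2 * y * z + (point_dist C A)^2 * z * x
       + (point_dist A B)^2 * x * y).
Proof.
  intros s s' Hs Hs' x y z. rewrite !point_dist_sq.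
  unfold barycentric, x, y, z; cbn [fst snd]. fold s s'.
  assert (Hw : w = s - u - v) by (unfold s; ring).
  assert (Hw' : w' = s' - u' - v') by (unfold s'; ring).
  clearbody s s'. subst w w'. field. split; assumption.
Qed.

(** The default branch serves n = 10. For n = 6 its value is junk; the sum [2 * (p^2 - q)] of the
    weights of X_6 is treated separately. *)
Definition weight_sum (n : nat) (p q r : R) : R :=
  match n with
  | 1%nat => 2 * p
  | 2%nat => 3
  | 3%nat => - 16 * p * r
  | 4%nat => 16 * p * r
  | 5%nat => - 32 * p * r
  | 7%nat => 4 * q
  | 8%nat => - 2 * p
  | 9%nat => - 4 * q
  | _ => 4 * p
  end.

(** After multiplication by the squared weight sum of X_n, this is a polynomial identity in x, y, z
    for each n. *)
Lemma center_dist_sq (A B C : point) (n : nat) (x y z : R) :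
  (1 <= n <= 10)%nat -> n <> 6%nat ->
  0 < x -> 0 < y -> 0 < z ->
  point_dist B C = y + z -> point_dist C A = z + x -> point_dist A B = x + y ->
  let p := x + y + z in let q := x * y + y * z + z * x in
  let r := x * y * z in
  (center_dist A B C 6 n)^2 * (2 * (p^2 - q))^2 * dist_den n p q r = dist_num n p q r.
Proof.
  intros Hn Hn6 Hx Hy Hz Ha Hb Hc p q r.
  unfold center_dist, center. rewrite Ha, Hb, Hc.
  assert (Hxy := Rmult_lt_0_compat _ _ Hx Hy).
  assert (Hyz := Rmult_lt_0_compat _ _ Hy Hz).
  assert (Hzx := Rmult_lt_0_compat _ _ Hz Hx).
  assert (Hp : 0 < p) by (unfold p; lra).
  assert (Hq : 0 < q) by (unfold q; lra).
  assert (Hr : 0 < r) by (apply Rmult_lt_0_compat; lra).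
  assert (Hpr := Rmult_lt_0_compat _ _ Hp Hr).
  assert (Hw : weight_sum n p q r <> 0).
  { do 11 (destruct n as [|n]; [cbn [weight_sum]; lra|]). cbn [weight_sum]. lra. }
  assert (E6 : center_function 6 (y + z) (z + x) (x + y)
               + center_function 6 (z + x) (x + y) (y + z)
               + center_function 6 (x + y) (y + z) (z + x) = 2 * (p^2 - q))
    by (unfold p, q; cbn [center_function]; ring).
  assert (H6 : 2 * (p^2 - q) <> 0) by (unfold p, q; nra).
  assert (E : center_function n (y + z) (z + x) (x + y)
               + center_function n (z + x) (x + y) (y + z)
               + center_function n (x + y) (y + z) (z + x) = weight_sum n p q r).
  { do 11 (destruct n as [|n];
      [try lia; unfold p, q, r; cbn [center_function weight_sum]; ring|]). lia. }
  pose proof (barycentric_dist_sq A B C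
    (center_function 6 (y + z) (z + x) (x + y))
    (center_function 6 (z + x) (x + y) (y + z))
    (center_function 6 (x + y) (y + z) (z + x))
    (center_function n (y + z) (z + x) (x + y))
    (center_function n (z + x) (x + y) (y + z))
    (center_function n (x + y) (y + z) (z + x))) as H.
  cbv zeta in H. rewrite Ha, Hb, Hc, E6, E in H. specialize (H H6 Hw).
  apply (Rmult_eq_reg_r ((weight_sum n p q r)^2)); [| now apply pow_nonzero].
  match goal with
  | |- ?D * _ * ?d * ?w = _ =>
      transitivity (D * (2 * (p^2 - q) * weight_sum n p q r)^2 * d); [ring|]
  end.
  rewrite H. clear H E E6 H6 Hw Ha Hb Hc.
  do 11 (destruct n as [|n]; [try lia; unfold p, q, r, dist_num, dist_den;
      cbn [center_function weight_sum dist_num_coef dist_den_coef dist_den_has_r]; ring|]).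
  lia.
Qed.

(** Squares are compared; the factor [(2 * (p^2 - q))^2] is common to both sides and cancels. *)
Lemma center_dist_le (A B C : point) (i j : nat) (k : R) :
  nondegenerate A B C -> (1 <= i <= 10)%nat -> i <> 6%nat ->
  (1 <= j <= 10)%nat -> j <> 6%nat -> 0 <= k ->
  (forall x y z, 0 < x -> 0 < y -> 0 < z ->
     let p := x + y + z in let q := x * y + y * z + z * x in let r := x * y * z in
     dist_num i p q r * dist_den j p q r <= k^2 * (dist_num j p q r * dist_den i p q r)) ->
  center_dist A B C 6 i <= k * center_dist A B C 6 j.
Proof.
  intros HABC Hi Hi6 Hj Hj6 Hk H.
  destruct (triangle_ravi A B C HABC) as (x & y & z & Hx & Hy & Hz & Ha & Hb & Hc).
  pose proof (center_dist_sq A B C i x y z Hi Hi6 Hx Hy Hz Ha Hb Hc) as Ei.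
  pose proof (center_dist_sq A B C j x y z Hj Hj6 Hx Hy Hz Ha Hb Hc) as Ej.
  specialize (H x y z Hx Hy Hz). cbv zeta in H, Ei, Ej.
  set (p := x + y + z) in *. set (q := x * y + y * z + z * x) in *.
  set (r := x * y * z) in *.
  assert (Hxy := Rmult_lt_0_compat _ _ Hx Hy).
  assert (Hyz := Rmult_lt_0_compat _ _ Hy Hz).
  assert (Hzx := Rmult_lt_0_compat _ _ Hz Hx).
  assert (Hr : 0 < r) by (apply Rmult_lt_0_compat; lra).
  assert (Hp : 0 < p) by (unfold p; lra).
  assert (Hq : 0 < q) by (unfold q; lra).
  assert (Hs : 0 < 2 * (p^2 - q)) by (unfold p, q; nra).
  pose proof (dist_den_pos i p q r Hp Hq Hr) as Hdi.
  pose proof (dist_den_pos j p q r Hp Hq Hr) as Hdj.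
  pose proof (point_dist_nonneg (center A B C 6) (center A B C j)) as Hj0.
  fold (center_dist A B C 6 j) in Hj0.
  rewrite <- Ei, <- Ej in H.
  set (Di := center_dist A B C 6 i) in *. set (Dj := center_dist A B C 6 j) in *.
  assert (Hw : 0 < (2 * (p^2 - q))^2 * (dist_den i p q r * dist_den j p q r))
    by (apply Rmult_lt_0_compat; [now apply pow_lt | now apply Rmult_lt_0_compat]).
  apply Rle_trans with (Rabs Di); [apply Rle_abs |].
  rewrite <- (Rabs_pos_eq (k * Dj)) by now apply Rmult_le_pos.
  apply Rsqr_le_abs_0. unfold Rsqr.
  apply (Rmult_le_reg_l _ _ _ Hw). lra.
Qed.

(** * Cubics on the region of triangles *)

(* The four expressions are 3 times the Bernstein coefficients on [l, u] of the
   cubic with coefficients c0, ..., c3. *)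
Definition polar_nonneg (l u c0 c1 c2 c3 : R) : Prop :=
  0 <= 3 * c0 + 3 * c1 * l + 3 * c2 * l^2 + 3 * c3 * l^3 /\
  0 <= 3 * c0 + c1 * (2 * l + u) + c2 * (l^2 + 2 * l * u) + 3 * c3 * l^2 * u /\
  0 <= 3 * c0 + c1 * (l + 2 * u) + c2 * (2 * l * u + u^2) + 3 * c3 * l * u^2 /\
  0 <= 3 * c0 + 3 * c1 * u + 3 * c2 * u^2 + 3 * c3 * u^3.

(** In the Bernstein basis of [l, u] the cubic has nonnegative coefficients. The case [l = u], where
    this basis degenerates, occurs for equilateral triangles. *)
Lemma cubic_nonneg (l u c0 c1 c2 c3 x : R) :
  polar_nonneg l u c0 c1 c2 c3 -> l <= x <= u ->
  0 <= c0 + c1 * x + c2 * x^2 + c3 * x^3.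
Proof.
  intros (H0 & H1 & H2 & H3) [Hl Hu].
  destruct (Req_dec l u) as [<- | Hlu].
  - replace x with l by lra. lra.
  - assert (Hd : 0 < 3 * (u - l)^3) by (apply Rmult_lt_0_compat, pow_lt; lra).
    apply (Rmult_le_reg_l _ _ _ Hd).
    replace (3 * (u - l)^3 * (c0 + c1 * x + c2 * x^2 + c3 * x^3)) with
      ((u - x)^3 * (3 * c0 + 3 * c1 * l + 3 * c2 * l^2 + 3 * c3 * l^3)
       + 3 * ((u - x)^2 * (x - l))
         * (3 * c0 + c1 * (2 * l + u) + c2 * (l^2 + 2 * l * u) + 3 * c3 * l^2 * u)
       + 3 * ((u - x) * (x - l)^2)
         * (3 * c0 + c1 * (l + 2 * u) + c2 * (2 * l * u + u^2) + 3 * c3 * l * u^2)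
       + (x - l)^3 * (3 * c0 + 3 * c1 * u + 3 * c2 * u^2 + 3 * c3 * u^3)) by ring.
    rewrite Rmult_0_r.
    assert (0 <= u - x) by lra. assert (0 <= x - l) by lra.
    repeat apply Rplus_le_le_0_compat;
      repeat apply Rmult_le_pos; try apply pow_le; lra.
Qed.

(* For given p and q, the product r = xyz lies between its values at the isosceles
   triangles (x,y,z) = (e + 3d, e + 3d, e) and (e + d, e + d, e + 4d), or, if these
   p and q are not attained in this way with e >= 0, between 0 and its value at
   (f, f, 4f + 3g). *)
Definition extremal_polar_nonneg (c : nat -> R -> R -> R) : Prop :=
  (forall d e, 0 <= d -> 0 <= e ->
     let p := 3 * (e + 2 * d) in let q := 3 * (e + d) * (e + 3 * d) in
     polar_nonneg (e * (e + 3 * d)^2) ((e + d)^2 * (e + 4 * d))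
       (c 0%nat p q) (c 1%nat p q) (c 2%nat p q) (c 3%nat p q)) /\
  (forall f g, 0 <= f -> 0 <= g ->
     let p := 3 * (2 * f + g) in let q := 3 * f * (3 * f + 2 * g) in
     polar_nonneg 0 (f^2 * (4 * f + 3 * g))
       (c 0%nat p q) (c 1%nat p q) (c 2%nat p q) (c 3%nat p q)).

Lemma cubic_nonneg_on_triangles (c : nat -> R -> R -> R) :
  extremal_polar_nonneg c ->
  forall x y z, 0 < x -> 0 < y -> 0 < z ->
    let p := x + y + z in let q := x * y + y * z + z * x in
    let r := x * y * z in
    0 <= c 0%nat p q + c 1%nat p q * r + c 2%nat p q * r^2 + c 3%nat p q * r^3.
Proof.
  intros [H1 H2] x y z Hx Hy Hz p q r.
  pose (d := sqrt (p^2 - 3 * q) / 3).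
  assert (HD : 0 <= p^2 - 3 * q).
  { replace (p^2 - 3 * q) with (((x - y)^2 + (y - z)^2 + (z - x)^2) / 2)
      by (unfold p, q; field).
    pose proof (pow2_ge_0 (x - y)). pose proof (pow2_ge_0 (y - z)).
    pose proof (pow2_ge_0 (z - x)). lra. }
  assert (Hd : 0 <= d) by (unfold d; pose proof (sqrt_pos (p^2 - 3 * q)); lra).
  assert (Hd2 : 9 * d^2 = p^2 - 3 * q).
  { unfold d. rewrite <- (pow2_sqrt _ HD) at 2. field. }
  assert (Hxy := Rmult_lt_0_compat _ _ Hx Hy).
  assert (Hr : 0 < r) by (apply Rmult_lt_0_compat; lra).
  assert (Hq : 0 < q).
  { pose proof (Rmult_lt_0_compat _ _ Hy Hz).
    pose proof (Rmult_lt_0_compat _ _ Hz Hx). unfold q. lra. }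
  assert (Hp : 0 < p) by (unfold p; lra).
  assert (Hdp : 3 * d <= p) by nra.
  (* The discriminant of the cubic with roots x, y, z is a square, which confines r to an interval
     with isosceles ends. *)
  assert (HT : (27 * r - 9 * p * q + 2 * p^3)^2 <= (54 * d^3)^2).
  { replace ((54 * d^3)^2) with (4 * (9 * d^2)^3) by ring. rewrite Hd2.
    assert (0 <= 27 * ((x - y) * (y - z) * (z - x))^2)
      by (apply Rmult_le_pos; [lra | apply pow2_ge_0]).
    assert (27 * ((x - y) * (y - z) * (z - x))^2
            = 4 * (p^2 - 3 * q)^3 - (27 * r - 9 * p * q + 2 * p^3)^2)
      by (unfold p, q, r; ring). lra. }
  assert (Hd3 : 0 <= 54 * d^3) by (apply Rmult_le_pos, pow_le; lra).
  assert (Hq' : q = (p^2 - 9 * d^2) / 3) by lra.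
  assert (Hr1 : 27 * r <= 9 * p * q - 2 * p^3 + 54 * d^3) by nra.
  assert (Hr2 : 9 * p * q - 2 * p^3 - 54 * d^3 <= 27 * r) by nra.
  clear HT Hd3. clearbody d p q r. subst q.
  destruct (Rle_dec 0 (p / 3 - 2 * d)) as [He | He].
  - specialize (H1 d (p / 3 - 2 * d) Hd He). cbv zeta in H1.
    replace (3 * (p / 3 - 2 * d + 2 * d)) with p in H1 by field.
    replace (3 * (p / 3 - 2 * d + d) * (p / 3 - 2 * d + 3 * d))
      with ((p^2 - 9 * d^2) / 3) in H1 by field.
    apply (cubic_nonneg _ _ _ _ _ _ _ H1). split; lra.
  - specialize (H2 (p / 3 - d) (2 * d - p / 3) ltac:(lra) ltac:(lra)).
    cbv zeta in H2.
    replace (3 * (2 * (p / 3 - d) + (2 * d - p / 3))) with p in H2 by field.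
    replace (3 * (p / 3 - d) * (3 * (p / 3 - d) + 2 * (2 * d - p / 3)))
      with ((p^2 - 9 * d^2) / 3) in H2 by field.
    apply (cubic_nonneg _ _ _ _ _ _ _ H2). split; lra.
Qed.

(** The square of the constant of the bound enters as m / n, with integers m and n when the constant
    is rational. *)
Definition diff_coef (i j : nat) (m n : R) (k : nat) (p q : R) : R :=
  m * dist_num_coef j k p q * dist_den_coef i p q
  - n * dist_num_coef i k p q * dist_den_coef j p q.

(* Unlike the denominator for X_i, the one for X_3 has a factor r, whence the shift. *)
Definition diff3_coef (i : nat) (m n : R) (k : nat) (p q : R) : R :=
  m * dist_num_coef 3 k p q * dist_den_coef i p q
  - match k with O => 0 | S k' => n * dist_num_coef i k' p q * dist_den_coef 3 p q end.

(** A factor r occurring in both denominators cancels, so that the difference stays cubic in r. *)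
Lemma center_dist_le_polar (A B C : point) (i j : nat) (k m n : R) :
  nondegenerate A B C -> (1 <= i <= 10)%nat -> i <> 6%nat ->
  (1 <= j <= 10)%nat -> j <> 6%nat -> dist_den_has_r i = dist_den_has_r j ->
  0 <= k -> 0 < n -> n * k^2 = m ->
  extremal_polar_nonneg (diff_coef i j m n) ->
  center_dist A B C 6 i <= k * center_dist A B C 6 j.
Proof.
  intros HABC Hi Hi6 Hj Hj6 Hij Hk Hn Hm H.
  apply center_dist_le; try assumption.
  intros x y z Hx Hy Hz p q r.
  pose proof (cubic_nonneg_on_triangles _ H x y z Hx Hy Hz) as Hc.
  cbv zeta in Hc. fold p q r in Hc.
  unfold dist_den. rewrite Hij.
  assert (Hr : 0 <= if dist_den_has_r j then r else 1).
  { destruct (dist_den_has_r j); [| lra]. repeat apply Rmult_le_pos; lra. }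
  set (t := if dist_den_has_r j then r else 1) in *.
  enough (dist_num i p q r * dist_den_coef j p q
          <= k^2 * (dist_num j p q r * dist_den_coef i p q)) by nra.
  apply (Rmult_le_reg_l _ _ _ Hn). rewrite <- (Rmult_assoc n (k^2)), Hm.
  unfold dist_num. unfold diff_coef in Hc. lra.
Qed.

Lemma center_dist_le_polar3 (A B C : point) (i : nat) (k m n : R) :
  nondegenerate A B C -> (1 <= i <= 10)%nat -> i <> 6%nat ->
  dist_den_has_r i = false -> (forall p q, dist_num_coef i 3 p q = 0) ->
  0 <= k -> 0 < n -> n * k^2 = m ->
  extremal_polar_nonneg (diff3_coef i m n) ->
  center_dist A B C 6 i <= k * center_dist A B C 6 3.
Proof.
  intros HABC Hi Hi6 Hir Hi3 Hk Hn Hm H.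
  apply center_dist_le; try assumption; try lia.
  intros x y z Hx Hy Hz p q r.
  pose proof (cubic_nonneg_on_triangles _ H x y z Hx Hy Hz) as Hc.
  cbv zeta in Hc. fold p q r in Hc.
  unfold dist_den. rewrite Hir. cbn [dist_den_has_r].
  apply (Rmult_le_reg_l _ _ _ Hn). rewrite <- (Rmult_assoc n (k^2)), Hm.
  unfold dist_num. rewrite Hi3. unfold diff3_coef in Hc. lra.
Qed.

Ltac nonneg_poly :=
  match goal with
  | |- 0 <= _ + _ => apply Rplus_le_le_0_compat; nonneg_poly
  | |- 0 <= _ * _ => apply Rmult_le_pos; nonneg_poly
  | |- 0 <= _ ^ _ => apply pow_le; nonneg_poly
  | |- _ => lra
  end.

(** Expands each Bernstein coefficient as a form in d, e or f, g. A form with a negative coefficient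
    is left as a goal. *)
Ltac extremal_polar :=
  split; intros ? ? ? ? p q; subst p q; unfold diff_coef, diff3_coef;
  cbn [dist_num_coef dist_den_coef]; unfold polar_nonneg; repeat split;
  match goal with |- 0 <= ?e => ring_simplify e end; try nonneg_poly.

Ltac dist_le i j k m n :=
  apply (center_dist_le_polar _ _ _ i j k m n);
  [assumption | lia | lia | lia | lia | reflexivity | lra | lra | lra | extremal_polar].

Ltac dist_le3 i k m n :=
  apply (center_dist_le_polar3 _ _ _ i k m n);
  [assumption | lia | lia | reflexivity | reflexivity | lra | lra | lra | extremal_polar].

(** * The two quadratic irrational bounds *)

Lemma dist_1_2_le (A B C : point) :
  nondegenerate A B C ->
  center_dist A B C 6 1 <= (9 - 6 * sqrt 2) * center_dist A B C 6 2.
Proof.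
  intros HABC.
  assert (Ht : sqrt 2 * sqrt 2 = 2) by (apply sqrt_sqrt; lra).
  pose proof (sqrt_pos 2) as Ht0. set (t := sqrt 2) in *. clearbody t.
  assert (Ht1 : t <= 14142136 / 10^7) by nra.
  set (k := 9 - 6 * t).
  assert (Hk : 0 <= k) by (unfold k; lra).
  (* Since 0.2649 is just below [k^2], the excess [eps] acts as a further nonnegative variable, and
     sign inspection settles all forms but one. *)
  set (eps := 10000 * k^2 - 2649).
  assert (Heps : 0 <= eps) by (unfold eps, k; nra).
  apply (center_dist_le_polar A B C 1 2 k (eps + 2649) 10000);
    try assumption; try lia; try lra; [reflexivity | unfold eps; lra |].
  extremal_polar.
  (* The isosceles triangles with [3 d = sqrt 2 e] are extremal. *)
  set (u := 4 * e^2 + 17 * (e * d) + 18 * d^2).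
  set (v := 2 * e^2 + 9 * (e * d) + 9 * d^2).
  match goal with |- 0 <= ?x =>
    replace x with (9720000 * e * d^2 * ((k * u - v) * (k * u + v)))
      by (unfold eps, u, v; ring) end.
  (* As a quadratic form in d and e, [k * u - v] has discriminant proportional to [k^2 - 18 k + 9],
     which vanishes at this k. *)
  replace (k * u - v) with ((k * d - (3 * t - 4) * e)^2)
    by (unfold k, u, v; ring [Ht]).
  apply Rmult_le_pos; [nonneg_poly |].
  apply Rmult_le_pos; [apply pow2_ge_0 | unfold u, v; nonneg_poly].
Qed.

Lemma dist_1_3_le (A B C : point) :
  nondegenerate A B C ->
  center_dist A B C 6 1 <= (2 - sqrt 3) * center_dist A B C 6 3.
Proof.
  intros HABC.
  assert (Ht : sqrt 3 * sqrt 3 = 3) by (apply sqrt_sqrt; lra).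
  pose proof (sqrt_pos 3) as Ht0. set (t := sqrt 3) in *. clearbody t.
  assert (Ht1 : t <= 173205081 / 10^8) by nra.
  set (k := 2 - t).
  assert (Hk : 0 <= k) by (unfold k; lra).
  (* Again 0.0717 is just below [k^2]. *)
  set (eps := 10000 * k^2 - 717).
  assert (Heps : 0 <= eps) by (unfold eps, k; nra).
  apply (center_dist_le_polar3 A B C 1 k (eps + 717) 10000);
    try assumption; try lia; try lra; [reflexivity | reflexivity | unfold eps; lra |].
  extremal_polar.
  (* The isosceles triangles with [(3 sqrt 3 + 1) d = 2 e] are extremal. *)
  set (u := (2 * e + 5 * d) * (4 * e + 7 * d)).
  set (v := 2 * ((e + d) * (e + 4 * d))).
  match goal with |- 0 <= ?x =>
    replace x with (324 * 10000 * (e + 2 * d) * d^2 * ((e + d) * (2 * e + 5 * d))^2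
                    * ((k * u - v) * (k * u + v)))
      by (unfold eps, u, v; ring) end.
  (* The discriminant is proportional to [k^2 - 4 k + 1], which vanishes at [2 - sqrt 3]. *)
  assert (E : 2 * (k * u - v) = ((5 * t - 7) * d - 2 * k * e)^2)
    by (unfold k, u, v; ring [Ht]).
  pose proof (pow2_ge_0 ((5 * t - 7) * d - 2 * k * e)).
  apply Rmult_le_pos; [nonneg_poly |].
  apply Rmult_le_pos; [lra | unfold u, v; nonneg_poly].
Qed.

(* With v the vector from X_6 to X_1 and w the vector from X_1 to X_8, the
   points X_2, X_10 and X_8 are X_6 + v + t w for t = 1/3, 1/2, 1. *)
Lemma nagel_line (A B C : point) :
  nondegenerate A B C ->
  exists v1 v2 w1 w2,
    let dist_sq t := (v1 + t * w1)^2 + (v2 + t * w2)^2 in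
    (center_dist A B C 6 1)^2 = dist_sq 0 /\
    (center_dist A B C 6 2)^2 = dist_sq (1/3) /\
    (center_dist A B C 6 10)^2 = dist_sq (1/2) /\
    (center_dist A B C 6 8)^2 = dist_sq 1.
Proof.
  intros HABC.
  destruct (triangle_ravi A B C HABC) as (x & y & z & Hx & Hy & Hz & Ha & Hb & Hc).
  exists (fst (center A B C 1) - fst (center A B C 6)),
    (snd (center A B C 1) - snd (center A B C 6)),
    (fst (center A B C 8) - fst (center A B C 1)),
    (snd (center A B C 8) - snd (center A B C 1)).
  cbv zeta. unfold center_dist.
  assert (H2 : forall f, f = fst \/ f = snd ->
    f (center A B C 2) = (2 * f (center A B C 1) + f (center A B C 8)) / 3 /\
    f (center A B C 10) = (f (center A B C 1) + f (center A B C 8)) / 2).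
  { intros f [-> | ->]; unfold center; rewrite Ha, Hb, Hc;
    cbn [barycentric center_function fst snd]; split; field; lra. }
  destruct (H2 fst) as [E1 E2]; [now left |]. destruct (H2 snd) as [E3 E4]; [now right |].
  rewrite !point_dist_sq, E1, E2, E3, E4. repeat split; field.
Qed.

(** The quotient [dist_sq t / (tau + t)^2] is a quadratic function of [1 / (tau + t)] with leading
    coefficient [Z >= 0], hence convex. The hypothesis says that a chord of it has nonpositive
    slope, and moving both ends of the chord to the left preserves this. *)
Lemma apollonius_weaken (v1 v2 w1 w2 tau a b a' b' : R) :
  let dist_sq t := (v1 + t * w1)^2 + (v2 + t * w2)^2 in
  0 < tau -> 0 <= a < b -> a <= a' -> b <= b' -> a' < b' ->
  (tau + b)^2 * dist_sq a <= (tau + a)^2 * dist_sq b ->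
  (tau + b')^2 * dist_sq a' <= (tau + a')^2 * dist_sq b'.
Proof.
  intros dist_sq Ht Hab Ha Hb Hab' H.
  set (Z := (v1 - tau * w1)^2 + (v2 - tau * w2)^2).
  set (W := 2 * ((v1 - tau * w1) * w1 + (v2 - tau * w2) * w2)).
  assert (E : forall c d, (tau + d)^2 * dist_sq c - (tau + c)^2 * dist_sq d
    = (d - c) * (Z * (tau + c + (tau + d)) + W * ((tau + c) * (tau + d))))
    by (intros; unfold dist_sq, Z, W; ring).
  assert (HZ : 0 <= Z) by (apply Rplus_le_le_0_compat; apply pow2_ge_0).
  pose proof (E a b) as E1. pose proof (E a' b') as E2. clear E.
  clearbody Z W dist_sq.
  set (s := tau + a) in *. set (t := tau + b) in *.
  set (s' := tau + a') in *. set (t' := tau + b') in *.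
  assert (H1 : Z * (s + t) + W * (s * t) <= 0).
  { apply (Rmult_le_reg_l (b - a)); lra. }
  assert (Hs : 0 < s) by (unfold s; lra). assert (Hst : s < t) by (unfold s, t; lra).
  assert (Hs' : s <= s') by (unfold s, s'; lra).
  assert (Ht' : t <= t') by (unfold t, t'; lra).
  assert (H2 : Z * (s' + t') + W * (s' * t') <= 0).
  { apply (Rmult_le_reg_l (s * t)); [apply Rmult_lt_0_compat; lra |].
    assert (0 <= Z * (s * s' * (t' - t) + t * t' * (s' - s))).
    { apply Rmult_le_pos; [exact HZ |].
      apply Rplus_le_le_0_compat; repeat apply Rmult_le_pos; lra. }
    assert (s' * t' * (Z * (s + t) + W * (s * t)) <= s' * t' * 0)
      by (apply Rmult_le_compat_l; [apply Rmult_le_pos |]; lra).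
    lra. }
  assert ((b' - a') * (Z * (s' + t') + W * (s' * t')) <= (b' - a') * 0)
    by (apply Rmult_le_compat_l; lra).
  lra.
Qed.

(** With [tau = sqrt 2 / 4] one has [9 - 6 * sqrt 2 = (tau + 0) / (tau + 1/3)], and the other
    constants are [(tau + a') / (tau + b')] for the parameters of the two centers, the last one
    after inversion. *)
Lemma nagel_line_le (A B C : point) :
  nondegenerate A B C ->
  center_dist A B C 6 1 <= (2 * sqrt 2 - 1) / 7 * center_dist A B C 6 8 /\
  center_dist A B C 6 1 <= (sqrt 2 - 1) * center_dist A B C 6 10 /\
  center_dist A B C 6 2 <= (5 + 4 * sqrt 2) / 21 * center_dist A B C 6 8 /\
  center_dist A B C 6 2 <= (1 + sqrt 2) / 3 * center_dist A B C 6 10 /\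
  (3 - sqrt 2) * center_dist A B C 6 10 <= center_dist A B C 6 8.
Proof.
  intros HABC. pose proof (dist_1_2_le A B C HABC) as H12.
  assert (Hpos : forall n, 0 <= center_dist A B C 6 n)
    by (intros; apply point_dist_nonneg).
  destruct (nagel_line A B C HABC) as (v1 & v2 & w1 & w2 & E1 & E2 & E10 & E8).
  pose proof (Hpos 1%nat) as P1. pose proof (Hpos 2%nat) as P2.
  pose proof (Hpos 8%nat) as P8. pose proof (Hpos 10%nat) as P10. clear Hpos.
  set (D1 := center_dist A B C 6 1) in *. set (D2 := center_dist A B C 6 2) in *.
  set (D8 := center_dist A B C 6 8) in *. set (D10 := center_dist A B C 6 10) in *.
  clearbody D1 D2 D8 D10.
  assert (Ht : sqrt 2 * sqrt 2 = 2) by (apply sqrt_sqrt; lra).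
  pose proof (sqrt_pos 2) as Ht0. set (t := sqrt 2) in *. clearbody t.
  assert (Ht1 : 1 < t < 3/2) by (split; nra).
  assert (H : (t/4 + 1/3)^2 * D1^2 <= (t/4 + 0)^2 * D2^2).
  { assert (H : (t/4 + 1/3) * D1 <= t/4 * D2).
    { replace (t/4 * D2) with ((t/4 + 1/3) * ((9 - 6 * t) * D2))
        by (field_simplify; rewrite ?Rpow_mult_distr; nra).
      apply Rmult_le_compat_l; lra. }
    rewrite <- !Rpow_mult_distr, Rplus_0_r. apply pow_incr.
    split; [apply Rmult_le_pos; lra | exact H]. }
  cbv beta in E1, E2, E10, E8. rewrite E1, E2 in H.
  assert (Hw : forall a' b' k D D',
    0 <= a' -> 1/3 <= b' -> a' < b' -> 0 <= D -> 0 <= D' ->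
    D^2 = (v1 + a' * w1)^2 + (v2 + a' * w2)^2 ->
    D'^2 = (v1 + b' * w1)^2 + (v2 + b' * w2)^2 ->
    t/4 + a' = k * (t/4 + b') -> D <= k * D').
  { intros a' b' k D D' Ha' Hb' Hab HD HD' ED ED' Hk.
    pose proof (apollonius_weaken v1 v2 w1 w2 (t/4) 0 (1/3) a' b') as Hap.
    cbv beta zeta in Hap.
    specialize (Hap ltac:(lra) ltac:(lra) ltac:(lra) ltac:(lra) ltac:(lra) H).
    rewrite <- ED, <- ED', <- !Rpow_mult_distr in Hap.
    assert (Hle : (t/4 + b') * D <= (t/4 + a') * D').
    { apply Rsqr_incr_0; [rewrite !Rsqr_pow2; exact Hap | |]; apply Rmult_le_pos; lra. }
    rewrite Hk in Hle. apply (Rmult_le_reg_l (t/4 + b')); lra. }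
  repeat split.
  - apply (Hw 0 1); try assumption; try lra.
  - apply (Hw 0 (1/2)); try assumption; try lra.
  - apply (Hw (1/3) 1); try assumption; try lra.
  - apply (Hw (1/3) (1/2)); try assumption; try lra.
  (* [(3 + sqrt 2) / 7] is the inverse of [3 - sqrt 2]. *)
  - assert (D10 <= (3 + t) / 7 * D8) by (apply (Hw (1/2) 1); try assumption; lra).
    nra.
Qed.

(** * The minimum of D(6,3)/D(6,7) *)

(* 9 times the tensor product Bernstein coefficients on [q0, q1] x [s0, s1]. *)
Definition bipolar_nonneg (q0 q1 s0 s1 : R) (c : nat -> nat -> R) : Prop :=
  let polar_s w0 w1 w2 w3 :=
    let b k := w0 * c 0%nat k + w1 * c 1%nat k + w2 * c 2%nat k + w3 * c 3%nat k in
    polar_nonneg s0 s1 (b 0%nat) (b 1%nat) (b 2%nat) (b 3%nat) in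
  polar_s 3 (3 * q0) (3 * q0^2) (3 * q0^3) /\
  polar_s 3 (2 * q0 + q1) (q0^2 + 2 * q0 * q1) (3 * q0^2 * q1) /\
  polar_s 3 (q0 + 2 * q1) (2 * q0 * q1 + q1^2) (3 * q0 * q1^2) /\
  polar_s 3 (3 * q1) (3 * q1^2) (3 * q1^3).

Definition bicubic (c : nat -> nat -> R) (q s : R) : R :=
  let row i := c i 0%nat + c i 1%nat * s + c i 2%nat * s^2 + c i 3%nat * s^3 in
  row 0%nat + row 1%nat * q + row 2%nat * q^2 + row 3%nat * q^3.

(** The univariate criterion is applied in s to each Bernstein coefficient in q, then in q. *)
Lemma bicubic_nonneg (q0 q1 s0 s1 : R) (c : nat -> nat -> R) (q s : R) :
  bipolar_nonneg q0 q1 s0 s1 c -> q0 <= q <= q1 -> s0 <= s <= s1 ->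
  0 <= bicubic c q s.
Proof.
  intros (H0 & H1 & H2 & H3) Hq Hs. apply (cubic_nonneg q0 q1); [| exact Hq].
  unfold polar_nonneg.
  apply (cubic_nonneg _ _ _ _ _ _ s) in H0, H1, H2, H3; try exact Hs.
  repeat split; [clear - H0 | clear - H1 | clear - H2 | clear - H3]; lra.
Qed.

(* With q and s standing for q/p^2 and r/(pq), the quotient of ratio_num by
   ratio_den is (D(6,3)/D(6,7))^2. *)
Definition ratio_num (q s : R) : R := q * (1 - s)^2 * ((1 - q)^2 - 12 * q * s).

Definition ratio_den (q s : R) : R :=
  4 * s * (q^2 - 4 * q^3 + 6 * q^2 * s - (12 - 36 * q + 27 * q^2) * s^2).

Definition ratio_coef (a b m : R) (i j : nat) : R :=
  match i, j with
  | 0%nat, 0%nat => m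
  | 0%nat, 3%nat => - 48 * b
  | 1%nat, 0%nat => a
  | 1%nat, 1%nat => - 2 * a
  | 1%nat, 2%nat => a
  | 1%nat, 3%nat => 144 * b
  | 2%nat, 0%nat => - 2 * a
  | 2%nat, 1%nat => - 8 * a + 4 * b
  | 2%nat, 2%nat => 22 * a + 24 * b
  | 2%nat, 3%nat => - 12 * a - 108 * b
  | 3%nat, 0%nat => a
  | 3%nat, 1%nat => - 2 * a - 16 * b
  | 3%nat, 2%nat => a
  | _, _ => 0
  end.

Lemma bicubic_ratio (a b m q s : R) :
  bicubic (ratio_coef a b m) q s = a * ratio_num q s + b * ratio_den q s + m.
Proof. unfold bicubic, ratio_coef, ratio_num, ratio_den. ring. Qed.

Ltac bipolar :=
  cbv [bipolar_nonneg polar_nonneg ratio_coef]; repeat split; lra.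

Lemma ratio_nonneg (q0 q1 s0 s1 a b m q s : R) :
  bipolar_nonneg q0 q1 s0 s1 (ratio_coef a b m) ->
  q0 <= q <= q1 -> s0 <= s <= s1 ->
  0 <= a * ratio_num q s + b * ratio_den q s + m.
Proof. rewrite <- bicubic_ratio. apply bicubic_nonneg. Qed.

Ltac ratio_by q0 q1 s0 s1 a b m q s :=
  let H := fresh in
  assert (H : 0 <= a * ratio_num q s + b * ratio_den q s + m)
    by (apply (ratio_nonneg q0 q1 s0 s1); [bipolar | lra | lra]);
  lra.

(** The range of q exceeds that of the small rectangle by 1/100 on both sides, the margin needed for
    [rectangle_min]. *)
Lemma ratio_den_pos (q s : R) :
  23/100 <= q <= 285/1000 -> 53/1000 <= s <= 68/1000 -> 1/10000 <= ratio_den q s.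
Proof.
  intros Hq Hs. ratio_by (23/100) (285/1000) (53/1000) (68/1000) 0 1 (-1/10000) q s.
Qed.

Lemma ratio_ge_60 (q s : R) :
  24/100 <= q <= 275/1000 -> 53/1000 <= s <= 68/1000 ->
  60 * ratio_den q s <= ratio_num q s.
Proof.
  intros Hq Hs.
  destruct (Rle_dec q (103/400)), (Rle_dec s (121/2000)).
  - ratio_by (24/100) (103/400) (53/1000) (121/2000) 1 (-60) 0 q s.
  - ratio_by (24/100) (103/400) (121/2000) (68/1000) 1 (-60) 0 q s.
  - ratio_by (103/400) (275/1000) (53/1000) (121/2000) 1 (-60) 0 q s.
  - ratio_by (103/400) (275/1000) (121/2000) (68/1000) 1 (-60) 0 q s.
Qed.

(** The constant 1244/5 in the proof is 4 times 311/5, the 4 being the leading factor of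
    [ratio_den]. *)
Lemma ratio_ge_corner (q s : R) :
  0 <= q <= 1/10 -> 0 <= s <= q/3 -> 311/5 * ratio_den q s <= ratio_num q s.
Proof.
  intros Hq Hs.
  (* Omitting the term with (2 - 3 q)^2 s^3 makes both sides multiples of q. *)
  pose (c i j := match i, j with
    | 0%nat, 0%nat => 1 | 0%nat, 1%nat => -2 | 0%nat, 2%nat => 1
    | 1%nat, 0%nat => -2 | 1%nat, 1%nat => -8 - 1244/5
    | 1%nat, 2%nat => 22 - 6 * (1244/5) | 1%nat, 3%nat => -12
    | 2%nat, 0%nat => 1 | 2%nat, 1%nat => -2 + 4 * (1244/5) | 2%nat, 2%nat => 1
    | _, _ => 0 end).
  assert (H : 0 <= bicubic c q s).
  { apply (bicubic_nonneg 0 (1/10) 0 (1/30)); [| lra | lra].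
    cbv [bipolar_nonneg polar_nonneg c]. repeat split; lra. }
  assert (H1 : 0 <= q * bicubic c q s) by (apply Rmult_le_pos; lra).
  assert (H2 : 0 <= s * s^2 * (2 - 3 * q)^2)
    by (repeat apply Rmult_le_pos; try apply pow2_ge_0; lra).
  unfold bicubic, c in H1. unfold ratio_num, ratio_den. nra.
Qed.

Ltac ratio_ge_outside_by q0 q1 s0 s1 q s :=
  ratio_by q0 q1 s0 s1 1 (-(311/5)) 0 q s.

(** The bound 311/5 exceeds a value taken inside the rectangle, so no point outside can be minimal.
    The region is cut into boxes on which the Bernstein test succeeds; the largest values 2/25 and
    1/9 of s come from [s <= q/3]. *)
Lemma ratio_ge_outside (q s : R) :
  0 <= q <= 1/3 -> 0 <= s <= q/3 ->
  (24/100 < q < 275/1000 -> 53/1000 < s < 68/1000 -> False) ->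
  311/5 * ratio_den q s <= ratio_num q s.
Proof.
  intros Hq Hs Hout.
  destruct (Rle_dec q (1/10)); [apply ratio_ge_corner; lra |].
  destruct (Rle_dec q (24/100)).
  { destruct (Rle_dec q (17/100)), (Rle_dec s (1/25)).
    - ratio_ge_outside_by (1/10) (17/100) 0 (1/25) q s.
    - ratio_ge_outside_by (1/10) (17/100) (1/25) (2/25) q s.
    - ratio_ge_outside_by (17/100) (24/100) 0 (1/25) q s.
    - destruct (Rle_dec q (41/200));
        [ratio_ge_outside_by (17/100) (41/200) (1/25) (2/25) q s |].
      destruct (Rle_dec s (1/20));
        [ratio_ge_outside_by (41/200) (24/100) (1/25) (1/20) q s |].
      destruct (Rle_dec s (3/50)).
      + ratio_ge_outside_by (41/200) (24/100) (1/20) (3/50) q s.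
      + ratio_ge_outside_by (41/200) (24/100) (3/50) (2/25) q s. }
  destruct (Rlt_dec q (275/1000)).
  { destruct (Rle_dec s (53/1000)), (Rle_dec q (103/400)).
    - ratio_ge_outside_by (24/100) (103/400) 0 (53/1000) q s.
    - ratio_ge_outside_by (103/400) (275/1000) 0 (53/1000) q s.
    - destruct (Rlt_dec s (68/1000)); [exfalso; apply Hout; lra |].
      ratio_ge_outside_by (24/100) (103/400) (68/1000) (1/9) q s.
    - destruct (Rlt_dec s (68/1000)); [exfalso; apply Hout; lra |].
      ratio_ge_outside_by (103/400) (275/1000) (68/1000) (1/9) q s. }
  destruct (Rle_dec s (1/18)); [ratio_ge_outside_by (275/1000) (1/3) 0 (1/18) q s |].
  destruct (Rle_dec q (73/240)).
  - destruct (Rle_dec s (5/72));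
      [ratio_ge_outside_by (275/1000) (73/240) (1/18) (5/72) q s |].
    destruct (Rle_dec s (1/12)).
    + destruct (Rle_dec q (139/480)).
      * ratio_ge_outside_by (275/1000) (139/480) (5/72) (1/12) q s.
      * ratio_ge_outside_by (139/480) (73/240) (5/72) (1/12) q s.
    + ratio_ge_outside_by (275/1000) (73/240) (1/12) (1/9) q s.
  - destruct (Rle_dec s (1/12)); [ratio_ge_outside_by (73/240) (1/3) (1/18) (1/12) q s |].
    destruct (Rle_dec q (51/160)).
    + ratio_ge_outside_by (73/240) (51/160) (1/12) (1/9) q s.
    + ratio_ge_outside_by (51/160) (1/3) (1/12) (1/9) q s.
Qed.

(** * Existence of a minimum and elimination at critical points *)

(** Minimize over y first, then over x. By uniform continuity the partial minimum is continuous in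
    x; the margin [eta] makes it so from both sides at a and b. *)
Lemma rectangle_min (f : R -> R -> R) (a b c d eta : R) :
  a <= b -> c <= d -> 0 < eta ->
  (forall x y, a - eta <= x <= b + eta -> c <= y <= d -> continuity_2d_pt f x y) ->
  exists x0 y0, a <= x0 <= b /\ c <= y0 <= d /\
    forall x y, a <= x <= b -> c <= y <= d -> f x0 y0 <= f x y.
Proof.
  intros Hab Hcd Heta Hf.
  assert (Hy : forall x, exists y, a - eta <= x <= b + eta ->
    c <= y <= d /\ forall y', c <= y' <= d -> f x y <= f x y').
  { intros x. destruct (excluded_middle_informative (a - eta <= x <= b + eta))
      as [Hx | Hx].
    - destruct (continuity_ab_min (f x) c d Hcd) as (y & H1 & H2).
      + intros y Hy eps Heps.
        destruct (Hf x y Hx Hy (mkposreal eps Heps)) as [delta Hdelta].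
        exists delta. split; [apply cond_pos |].
        intros y' [_ Hy']. apply Hdelta; [| exact Hy'].
        rewrite Rminus_diag, Rabs_R0. apply cond_pos.
      + exists y. intros _. split; assumption.
    - exists 0. intros H. contradiction. }
  pose (g x := proj1_sig (constructive_indefinite_description _ (Hy x))).
  assert (Hg : forall x, a - eta <= x <= b + eta ->
    c <= g x <= d /\ forall y', c <= y' <= d -> f x (g x) <= f x y')
    by (intros x; exact (proj2_sig (constructive_indefinite_description _ (Hy x)))).
  clearbody g.
  destruct (continuity_ab_min (fun x => f x (g x)) a b Hab) as (x0 & H1 & H2).
  - intros x Hx eps Heps.
    destruct (uniform_continuity_2d f (a - eta) (b + eta) c d Hf (mkposreal eps Heps))
      as [delta Hdelta].
    exists (Rmin delta eta).
    split; [apply Rmin_glb_lt; [apply cond_pos | exact Heta] |].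
    intros x' [_ Hx']. simpl in Hx' |- *. unfold R_dist in *.
    pose proof (Rmin_l delta eta). pose proof (Rmin_r delta eta).
    assert (Hxx : a - eta <= x <= b + eta) by lra.
    assert (Hx'' : a - eta <= x' <= b + eta)
      by (apply Rabs_def2 in Hx'; lra).
    destruct (Hg x Hxx) as [Hgx Hmin]. destruct (Hg x' Hx'') as [Hgx' Hmin'].
    assert (Hd : forall y, c <= y <= d -> Rabs (f x' y - f x y) < eps).
    { intros y Hyy. apply Hdelta; try assumption; [lra |].
      rewrite Rminus_diag, Rabs_R0. apply cond_pos. }
    (* The minimizer [g x] is tested at [x'], and [g x'] at [x]. *)
    pose proof (Rabs_def2 _ _ (Hd _ Hgx)). pose proof (Rabs_def2 _ _ (Hd _ Hgx')).
    specialize (Hmin _ Hgx'). specialize (Hmin' _ Hgx).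
    apply Rabs_def1; lra.
  - exists x0, (g x0). destruct (Hg x0) as [Hy0 _]; [lra |].
    repeat split; try tauto. intros x y Hx Hyy.
    apply Rle_trans with (f x (g x)); [now apply H1 |]. apply Hg; [lra | exact Hyy].
Qed.
(* Up to a nonzero factor, crit_q and crit_s are the numerators of the partial
   derivatives of ratio_num / ratio_den. *)
Definition crit_q (q s : R) : R :=
    - q^2 + 8 * q^3 - 7 * q^4 - 6 * q^2 * s - 42 * q^4 * s - 12 * s^2 + 48 * q * s^2
    - 81 * q^2 * s^2 + 72 * q^3 * s^2 - 27 * q^4 * s^2 + 288 * q * s^3
    - 432 * q^2 * s^3.

Definition crit_s (q s : R) : R :=
    - q^2 + 6 * q^3 - 9 * q^4 + 4 * q^5 - 13 * q^2 * s + 30 * q^3 * s - 21 * q^4 * s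
    + 4 * q^5 * s + 36 * s^2 - 180 * q * s^2 + 333 * q^2 * s^2 - 174 * q^3 * s^2
    - 15 * q^4 * s^2 - 12 * s^3 - 228 * q * s^3 + 753 * q^2 * s^3 - 486 * q^3 * s^3
    - 27 * q^4 * s^3.

(* The factor of degree 10 of the resultant of crit_q and crit_s with respect to s. *)
Definition eliminant (q : R) : R :=
    8 - 516 * q + 6098 * q^2 - 25595 * q^3 + 43085 * q^4 - 28775 * q^5 - 243 * q^6
    + 8719 * q^7 + 3279 * q^8 + 87 * q^9 - 3 * q^10.

Definition poly_K (k : R) : R :=
    7744 + 290960784 * k - 6782842860 * k^2 + 60418557684 * k^3 - 274035844587 * k^4
    + 677249814873 * k^5 - 894980577861 * k^6 + 603818269839 * k^7 - 160813808784 * k^8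
    + 2015974656 * k^9 + 6967296 * k^10.

(** A Bezout identity for the resultant: at a common zero of [crit_q] and [crit_s] the left-hand
    side vanishes. *)
Lemma eliminant_resultant (q s : R) :
  32 * q^2 * (1 - q)^2 * (1 - 3 * q)^3 * (q^4 + 14 * q^3 + 21 * q^2 - 4 * q + 4)
    * eliminant q
  = - ((
    1920 - 76608 * q - 1389408 * q^2 + 19683696 * q^3 - 126870216 * q^4
    + 520650276 * q^5 - 1371893394 * q^6 + 2267979117 * q^7 - 2200749273 * q^8
    + 985845840 * q^9 - 66094596 * q^10 + 154848042 * q^11 - 147667698 * q^12
    - 33007500 * q^13 - 1303938 * q^14 + 41553 * q^15 + 2187 * q^16) * s^2
    + (
    - 6016 + 379648 * q - 4254368 * q^2 + 25202656 * q^3 - 99189128 * q^4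
    + 274764928 * q^5 - 529091558 * q^6 + 672520726 * q^7 - 486082892 * q^8
    + 55566128 * q^9 + 181983492 * q^10 - 58484724 * q^11 - 30401136 * q^12
    - 2245824 * q^13 - 612846 * q^14 - 48114 * q^15 - 972 * q^16) * s
    + (
    768 - 53184 * q + 838208 * q^2 - 6360848 * q^3 + 29016544 * q^4 - 88473476 * q^5
    + 187495540 * q^6 - 270427103 * q^7 + 244860169 * q^8 - 114257300 * q^9
    + 8689048 * q^10 + 5423474 * q^11 + 9178554 * q^12 - 7282620 * q^13 + 1091676 * q^14
    + 257877 * q^15 + 2997 * q^16 - 324 * q^17)) * crit_q q s
    - ((
    46080 * q - 2783232 * q^2 + 25185024 * q^3 - 132602112 * q^4 + 458919360 * q^5
    - 991047168 * q^6 + 1271953872 * q^7 - 823551696 * q^8 + 102198672 * q^9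
    - 16645392 * q^10 + 144456048 * q^11 + 20540304 * q^12 - 11664 * q^13
    - 34992 * q^14) * s^2
    + (
    - 1920 + 114624 * q - 941088 * q^2 + 3248496 * q^3 - 6356664 * q^4 + 10454484 * q^5
    - 28043142 * q^6 + 81618597 * q^7 - 129565467 * q^8 + 71400636 * q^9
    + 21442320 * q^10 - 6546474 * q^11 - 24965226 * q^12 + 6822792 * q^13
    + 1316574 * q^14 + 3645 * q^15 - 2187 * q^16) * s
    + (
    256 - 17472 * q + 260672 * q^2 - 1787888 * q^3 + 7452480 * q^4 - 20471740 * q^5
    + 35464228 * q^6 - 25839249 * q^7 - 35570311 * q^8 + 101034324 * q^9
    - 84381636 * q^10 + 5425938 * q^11 + 21989646 * q^12 + 13894704 * q^13
    + 1406808 * q^14 + 14823 * q^15 - 1215 * q^16)) * crit_s q s.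
Proof. unfold eliminant, crit_q, crit_s. ring. Qed.

(* The subresultant of degree 1 of crit_q and crit_s with respect to s is
   q^2 (1 - q) (1 - 3q) (subres_lead q * s + subres_tail q). *)
Definition subres_lead (q : R) : R :=
    - 1920 + 113088 * q - 879744 * q^2 + 4205472 * q^3 - 12813432 * q^4 + 22073484 * q^5
    - 19887852 * q^6 + 4482876 * q^7 + 2466036 * q^8 + 4392612 * q^9 + 569916 * q^10
    - 972 * q^11 - 972 * q^12.

Definition subres_tail (q : R) : R :=
    - 256 + 16448 * q - 194112 * q^2 + 954656 * q^3 - 2601040 * q^4 + 4175172 * q^5
    - 3643684 * q^6 + 2093396 * q^7 - 1959060 * q^8 + 954828 * q^9 + 215316 * q^10
    - 10692 * q^11 - 972 * q^12.

(** At a common zero this gives a linear equation for s in terms of q. *)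
Lemma linear_subresultant (q s : R) :
  q^2 * (1 - q) * (1 - 3 * q)
    * (subres_lead q * s + subres_tail q)
  = ((
    - 64 + 2368 * q + 54192 * q^2 - 535184 * q^3 + 1883444 * q^4 - 2965956 * q^5
    + 1450833 * q^6 + 1143117 * q^7 - 1204794 * q^8 + 146286 * q^9 + 25029 * q^10
    + 729 * q^11) * s + (
    192 - 11712 * q + 109328 * q^2 - 464624 * q^3 + 1103700 * q^4 - 1481204 * q^5
    + 970607 * q^6 - 362781 * q^7 + 497250 * q^8 - 327654 * q^9 - 32373 * q^10
    - 729 * q^11)) * crit_q q s
    + ((
    - 1536 * q + 88320 * q^2 - 559104 * q^3 + 1431936 * q^4 - 1394784 * q^5
    - 187056 * q^6 + 890352 * q^7 - 182736 * q^8 - 11664 * q^9) * s + (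
    64 - 3840 * q + 32688 * q^2 - 128272 * q^3 + 336828 * q^4 - 573960 * q^5
    + 613053 * q^6 - 506313 * q^7 + 218754 * q^8 + 95418 * q^9 - 9963 * q^10
    - 729 * q^11)) * crit_s q s.
Proof. unfold subres_lead, subres_tail, crit_q, crit_s. ring. Qed.

(* At a critical point, s = s_num q / s_den q and the critical value is
   k_num q / k_den q; these low-degree fractions come from rational reconstruction
   modulo the eliminant. *)
Definition s_num (q : R) : R :=
    68 - 691 * q + 1695 * q^2 - 1007 * q^3 - 11 * q^4 - 6 * q^5.

Definition s_den (q : R) : R :=
    54 - 1347 * q - 147 * q^2 + 3339 * q^3 + 165 * q^4.

Definition k_num (q : R) : R :=
    - 18735221 + 851370037 * q + 4911597282 * q^2 + 1161358282 * q^3 - 94558101 * q^4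
    - 2433575 * q^5.

Definition k_den (q : R) : R :=
    312958304 - 3438616800 * q + 8225433628 * q^2 + 2332628472 * q^3 - 806344548 * q^4.

(** Certifies that [s_num / s_den] solves the linear equation for s modulo the eliminant. *)
Lemma s_numden (q : R) :
  subres_lead q * s_num q + subres_tail q * s_den q
  = eliminant q * (
    - 18048 + 117120 * q - 416256 * q^2 + 789504 * q^3 - 535896 * q^4 + 110808 * q^5
    - 8424 * q^6 - 1944 * q^7).
Proof. unfold subres_lead, subres_tail, s_num, s_den, eliminant. ring. Qed.

(** Both polynomials are cubic in s, so the factor [(s_den q)^3] allows [s * s_den q] to be replaced
    by [s_num q]. *)
Lemma k_numden (q s : R) :
  s * s_den q = s_num q ->
  (s_den q)^3 * (k_den q * ratio_num q s - k_num q * ratio_den q s)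
  = eliminant q * (
    - 35345718056832 + 510364894946880 * q - 1528738574831952 * q^2
    - 7263663760628448 * q^3 + 56740125750408240 * q^4 - 119553059785280064 * q^5
    + 89392816399086672 * q^6 - 8091592906419744 * q^7 - 8557850987977488 * q^8
    - 1459511108158656 * q^9 - 82667850120192 * q^10 - 1305442649664 * q^11
    - 18923479200 * q^12).
Proof.
  intros H.
  transitivity
    (k_den q * (q * (s_den q - s * s_den q)^2
                * ((1 - q)^2 * s_den q - 12 * q * (s * s_den q)))
     - k_num q * (4 * (s * s_den q)
                  * ((q^2 - 4 * q^3) * (s_den q)^2 + 6 * q^2 * (s * s_den q) * s_den q
                     - (12 - 36 * q + 27 * q^2) * (s * s_den q)^2))).
  { unfold ratio_num, ratio_den. ring. }
  rewrite H. unfold k_den, k_num, s_den, s_num, eliminant. ring.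
Qed.

(** The same device in degree 10: [poly_K], homogenized at [k_num] and [k_den], is a multiple of the
    eliminant. *)
Lemma poly_K_numden (q k : R) :
  k * k_den q = k_num q ->
  (k_den q)^10 * poly_K k = eliminant q * (
    -
    66205083144217827064594813406246218620957415194301427059048916068875719276901947255903037952
    + 7734435051238815793160245934174016935620367902189878077172377586739642047257166756963243556608 * q
    - 376507792801616563160142017456146711778788832293166268370128202903587224996944204716525094105984 * q^2
    + 9741330662498491427837429575704599098394651584041731505878683668893191698810360608130655819384640 * q^3
    - 138341474976529102557344633425986639667616355993211112122142935572097612349814725745414013270648576 * q^4
    + 903139080469970035201452728354814428429492475137567422633081216374910092324438027226218841077240896 * q^5
    + 1035310722186997765037990305595048696931196147631487005884961407347942849736676163190013011027020544 * q^6
    - 48293110504256165660031173275427857085986922608542853621823854452482472476451793841335275994437405184 * q^7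
    + 149961215971599678267599958762790259435223627252501603932892467486772137568732376831944323857091900416 * q^8
    + 764670596348309226803891824401982369884810189269842402973270669147802709439808343280708283875720097280 * q^9
    - 2681015520757915106055032335299694828823241453068258822492579342127984183847363251353724578906085971456 * q^10
    - 9811980632579232478442433239284337402972382843261225055481122568590278634495053036835575074372900534528 * q^11
    + 7603966064959891971899242071004259769888049259428490361888904529399270176461632506045443103342399918080 * q^12
    + 67613867431694489940185966657726440764958611040226585274272774202695363327279783500447810026143974150912 * q^13
    + 108159120745534149507206100007413720334393785903867120448914499013809255338107322914283025658761620052992 * q^14
    + 68760125812105780571260355914284355007443154292010340799139421260968456188029324547430909261389482606080 * q^15
    + 4965012090171823350173420120990230470946934548729965368946839366852945726541030252336008940429909024768 * q^16
    - 14601457298926022314485881760398801063281636050841653016149572642477242766843061137799141123986216110080 * q^17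
    - 4986708213132349048744992797815881133724968180858950815341145462264259540216408157420677972472967604480 * q^18
    + 1046966071989434429699942912774798418967599534980205122942672682316963603339963602046433341376845346688 * q^19
    + 722711570218102462797617145081599764854785853352040645822075517369152582668008761583208124576292395520 * q^20
    + 7654920263737489148100120874707437927005864857357327924400809153568156024918232127202301781118793088 * q^21
    - 47461901996355490422512699374908842901368668275693581801746492419516072583620668742063299951399468544 * q^22
    - 6364854201667514455881113061793992554756658840332100164188594328248962897428357992502059786680254976 * q^23
    + 1118996050515038487268901367969965743544133089303920491966516244437772957503141962214392827770756096 * q^24
    + 379334204171374012290513432728409554236720188395521653989065860142897358367605847439186089548438016 * q^25
    + 8492880871884724080696450749276170122879657803539440190066173586705626866981570051738344191238656 * q^26
    - 7544027017258598682983247624734015797016356401610429885769434256104316658605783596515740663177472 * q^27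
    + 5136136602728435690345540849968498782484003423882439997804409661576439941381978504894026708992 * q^28
    - 61467394948717295529879377409985418047174419819508238495507673526707727214761521224691777139968 * q^29
    - 19030961990368212636202090069538793374976022522134813080205343699519083244847188124297761956864 * q^30
    + 4354145913114246517787345819975124993263405767890449801369781560801377951438606801615435276800 * q^31
    - 211133773166956322391345248302104054536013455245223059206616472379612537740249370542723520000 * q^32
    + 1920109966546241547576991797283915629748274082576445754968928932457990603964098444388000000 * q^33
    + 57696958218081309903064496429157070531315511714749194272158260934205824525790147250000000 * q^34
    - 1741563249327084160206816374796608970363345136571830951181982755473074046785346875000000 * q^35
    + 12628644907807536329806382964604206961208007885220606305491493168490523263312500000000 * q^36
    - 39117297111173601919318607379096915458839150065252023266733133779957977734375000000 * q^37
    + 42263814294850290364696937953122330830111366091335433660698266954804687500000000 * q^38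
    - 1629200224774070134984475947103057670177043430297889356187644531250000000000 * q^39
    - 16919610430888068806465513683101769996942163167200071484375000000000000 * q^40).
Proof.
  intros H.
  transitivity
    ((7744) * (k_den q)^10
     + (290960784) * (k * k_den q)^1 * (k_den q)^9
     + (- 6782842860) * (k * k_den q)^2 * (k_den q)^8
     + (60418557684) * (k * k_den q)^3 * (k_den q)^7
     + (- 274035844587) * (k * k_den q)^4 * (k_den q)^6
     + (677249814873) * (k * k_den q)^5 * (k_den q)^5
     + (- 894980577861) * (k * k_den q)^6 * (k_den q)^4
     + (603818269839) * (k * k_den q)^7 * (k_den q)^3
     + (- 160813808784) * (k * k_den q)^8 * (k_den q)^2
     + (2015974656) * (k * k_den q)^9 * (k_den q)^1
     + (6967296) * (k * k_den q)^10).
  { unfold poly_K. ring. }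
  rewrite H. unfold k_den, k_num, eliminant. ring.
Qed.

Lemma is_derive_interior_min (f : R -> R) (a b x l : R) :
  is_derive f x l -> a < x < b -> (forall y, a < y < b -> f x <= f y) -> l = 0.
Proof.
  intros Hl Hx Hmin. apply is_derive_Reals in Hl.
  pose (pr := exist _ l Hl : derivable_pt f x).
  transitivity (derive_pt f x pr); [reflexivity |].
  apply (deriv_minimum f a b); [lra | lra | intros; apply Hmin; lra].
Qed.

(** The polynomial [ratio_num - k * ratio_den] has the minimum 0 at the point, so its partial
    derivatives vanish; eliminating k from them gives the two equations. *)
Lemma interior_min_critical (q s k : R) :
  24/100 < q < 275/1000 -> 53/1000 < s < 68/1000 ->
  k * ratio_den q s = ratio_num q s ->
  (forall q' s', 24/100 <= q' <= 275/1000 -> 53/1000 <= s' <= 68/1000 ->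
     k * ratio_den q' s' <= ratio_num q' s') ->
  crit_q q s = 0 /\ crit_s q s = 0.
Proof.
  intros Hq Hs Hk Hmin.
  set (nq := (1 - s)^2 * ((1 - q)^2 - 12 * q * s)
             + q * (1 - s)^2 * (- 2 * (1 - q) - 12 * s)).
  set (dq := 4 * s * (2 * q - 12 * q^2 + 12 * q * s - (54 * q - 36) * s^2)).
  set (ns := - 2 * q * (1 - s) * ((1 - q)^2 - 12 * q * s) - 12 * q^2 * (1 - s)^2).
  set (ds := 4 * (q^2 - 4 * q^3 + 12 * q^2 * s - 3 * (12 - 36 * q + 27 * q^2) * s^2)).
  assert (Hdq : nq - k * dq = 0).
  { apply (is_derive_interior_min (fun t => ratio_num t s - k * ratio_den t s)
      (24/100) (275/1000) q); [| lra |].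
    - unfold ratio_num, ratio_den, nq, dq. auto_derive; [exact I | ring].
    - intros t Ht. specialize (Hmin t s). lra. }
  assert (Hds : ns - k * ds = 0).
  { apply (is_derive_interior_min (fun t => ratio_num q t - k * ratio_den q t)
      (53/1000) (68/1000) s); [| lra |].
    - unfold ratio_num, ratio_den, ns, ds. auto_derive; [exact I | ring].
    - intros t Ht. specialize (Hmin q t). lra. }
  split.
  - apply (Rmult_eq_reg_l (4 * s * (1 - s)^2)).
    + rewrite Rmult_0_r.
      transitivity (ratio_den q s * (nq - k * dq)
                    + dq * (k * ratio_den q s - ratio_num q s)).
      * unfold ratio_den, ratio_num, crit_q, nq, dq. ring.
      * rewrite Hdq, Hk. ring.
    + apply Rgt_not_eq. apply Rmult_lt_0_compat, pow_lt; lra.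
  - apply (Rmult_eq_reg_l (4 * q * (1 - s))).
    + rewrite Rmult_0_r.
      transitivity (ratio_den q s * (ns - k * ds)
                    + ds * (k * ratio_den q s - ratio_num q s)).
      * unfold ratio_den, ratio_num, crit_s, ns, ds. ring.
      * rewrite Hds, Hk. ring.
    + apply Rgt_not_eq. apply Rmult_lt_0_compat; lra.
Qed.

Lemma subres_lead_pos (q : R) : 24/100 <= q <= 275/1000 -> 0 < subres_lead q.
Proof.
  intros Hq.
  (* Homogenization at [q = (48 v + 55 u) / (200 (u + v))], which maps u, v >= 0 to the interval.
     The constant -1921 instead of -1920 leaves room for strictness. *)
  assert (H : forall u v, 0 <= u -> 0 <= v -> 0 <=
    (-1921) * (48 * v + 55 * u)^0 * (200 * (u + v))^12 + (113088) * (48 * v + 55 *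
    u)^1 * (200 * (u + v))^11 + (-879744) * (48 * v + 55 * u)^2 * (200 * (u + v))^10 +
    (4205472) * (48 * v + 55 * u)^3 * (200 * (u + v))^9 + (-12813432) * (48 * v + 55 *
    u)^4 * (200 * (u + v))^8 + (22073484) * (48 * v + 55 * u)^5 * (200 * (u + v))^7 +
    (-19887852) * (48 * v + 55 * u)^6 * (200 * (u + v))^6 + (4482876) * (48 * v + 55 *
    u)^7 * (200 * (u + v))^5 + (2466036) * (48 * v + 55 * u)^8 * (200 * (u + v))^4 +
    (4392612) * (48 * v + 55 * u)^9 * (200 * (u + v))^3 + (569916) * (48 * v + 55 *
    u)^10 * (200 * (u + v))^2 + (-972) * (48 * v + 55 * u)^11 * (200 * (u + v))^1 +
    (-972) * (48 * v + 55 * u)^12 * (200 * (u + v))^0).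
  { intros u v Hu Hv. match goal with |- 0 <= ?e => ring_simplify e end. nonneg_poly. }
  specialize (H (200 * q - 48) (55 - 200 * q) ltac:(lra) ltac:(lra)).
  replace (48 * (55 - 200 * q) + 55 * (200 * q - 48)) with (1400 * q) in H by ring.
  replace (200 * (200 * q - 48 + (55 - 200 * q))) with 1400 in H by ring.
  unfold subres_lead. lra.
Qed.

(** The identities yield in turn the equations for q, s and k; each time the cofactor is nonzero on
    the rectangle. *)
Lemma critical_value_root (q s k : R) :
  24/100 < q < 275/1000 -> 53/1000 < s < 68/1000 ->
  crit_q q s = 0 -> crit_s q s = 0 -> k * ratio_den q s = ratio_num q s ->
  poly_K k = 0.
Proof.
  intros Hq Hs H1 H2 Hk.
  assert (Hm : eliminant q = 0).
  { pose proof (eliminant_resultant q s) as H.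
    rewrite H1, H2, !Rmult_0_r, Rminus_0_r in H.
    apply Rmult_integral in H. destruct H as [H | H]; [| exact H].
    exfalso. revert H. apply Rgt_not_eq.
    repeat apply Rmult_lt_0_compat; try apply pow_lt; try lra. nra. }
  assert (Hs' : s * s_den q = s_num q).
  { pose proof (subres_lead_pos q ltac:(lra)) as Hw.
    pose proof (linear_subresultant q s) as H.
    rewrite H1, H2, !Rmult_0_r, Rplus_0_r in H.
    apply Rmult_integral in H. destruct H as [H | H].
    - exfalso. revert H. apply Rgt_not_eq.
      repeat apply Rmult_lt_0_compat; try apply pow_lt; lra.
    - pose proof (s_numden q) as H3. rewrite Hm, Rmult_0_l in H3.
      assert (subres_lead q * (s * s_den q - s_num q) = 0).
      { transitivity ((subres_lead q * s + subres_tail q) * s_den q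
                      - (subres_lead q * s_num q + subres_tail q * s_den q)); [ring |].
        rewrite H, H3. ring. }
      assert (s * s_den q - s_num q = 0) by (apply (Rmult_eq_reg_l (subres_lead q)); lra).
      lra. }
  pose proof (ratio_den_pos q s ltac:(lra) ltac:(lra)) as Hd.
  assert (Hk' : k * k_den q = k_num q).
  { pose proof (k_numden q s Hs') as H. rewrite Hm, Rmult_0_l in H.
    apply Rmult_integral in H. destruct H as [H | H].
    - exfalso. revert H. apply pow_nonzero. unfold s_den.
      pose proof (pow_incr q (275/1000) 3 ltac:(lra)).
      pose proof (pow_incr q (275/1000) 4 ltac:(lra)).
      pose proof (pow2_ge_0 q). lra.
    - rewrite <- Hk in H. apply (Rmult_eq_reg_r (ratio_den q s)); lra. }
  pose proof (poly_K_numden q k Hk') as H. rewrite Hm, Rmult_0_l in H.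
  apply Rmult_integral in H. destruct H as [H | H]; [| exact H].
  (* If [k_den q] vanished, so would [k_num q], which is positive here. *)
  exfalso. revert H. apply pow_nonzero. intros H0.
  rewrite H0, Rmult_0_r in Hk'. unfold k_num in Hk'.
  pose proof (pow2_ge_0 q). pose proof (pow_le q 3 ltac:(lra)).
  pose proof (pow_incr q (275/1000) 4 ltac:(lra)).
  pose proof (pow_incr q (275/1000) 5 ltac:(lra)). lra.
Qed.

Ltac continuity_2d_poly :=
  repeat first
    [ apply continuity_2d_pt_mult | apply continuity_2d_pt_minus
    | apply continuity_2d_pt_plus | apply continuity_2d_pt_id1
    | apply continuity_2d_pt_id2 | apply continuity_2d_pt_const ].

Lemma ratio_min :
  exists k, 60 <= k <= 311/5 /\ poly_K k = 0 /\
    forall q s, 24/100 <= q <= 275/1000 -> 53/1000 <= s <= 68/1000 ->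
      k * ratio_den q s <= ratio_num q s.
Proof.
  destruct (rectangle_min (fun q s => ratio_num q s / ratio_den q s)
    (24/100) (275/1000) (53/1000) (68/1000) (1/100)) as (q & s & Hq & Hs & Hmin);
    try lra.
  { intros q s Hq Hs. pose proof (ratio_den_pos q s ltac:(lra) Hs).
    apply continuity_2d_pt_mult.
    - unfold ratio_num.
      continuity_2d_poly.
    - apply continuity_2d_pt_inv; [| lra]. unfold ratio_den.
      continuity_2d_poly. }
  set (k := ratio_num q s / ratio_den q s) in *.
  assert (Hk : k * ratio_den q s = ratio_num q s).
  { unfold k. field. pose proof (ratio_den_pos q s ltac:(lra) Hs). lra. }
  assert (Hle : forall q s, 24/100 <= q <= 275/1000 -> 53/1000 <= s <= 68/1000 ->
      k * ratio_den q s <= ratio_num q s).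
  { intros q' s' Hq' Hs'. pose proof (ratio_den_pos q' s' ltac:(lra) Hs') as Hd.
    specialize (Hmin q' s' Hq' Hs').
    apply (Rmult_le_reg_r (/ ratio_den q' s')); [apply Rinv_0_lt_compat; lra |].
    rewrite Rmult_assoc, Rinv_r, Rmult_1_r; [exact Hmin | lra]. }
  (* The ratio at this test point is about 61.84. *)
  assert (Hk62 : k < 311/5).
  { pose proof (Hle (256/1000) (602/10000) ltac:(lra) ltac:(lra)) as H.
    unfold ratio_den, ratio_num in H. lra. }
  pose proof (ratio_den_pos q s ltac:(lra) Hs) as Hd.
  assert (Hk60 : 60 <= k).
  { apply (Rmult_le_reg_r (ratio_den q s)); [lra |]. rewrite Hk. now apply ratio_ge_60. }
  assert (Hint : 24/100 < q < 275/1000 /\ 53/1000 < s < 68/1000).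
  { apply NNPP. intros Hn.
    assert (H : 311/5 * ratio_den q s <= ratio_num q s) by
      (apply ratio_ge_outside; lra || tauto).
    rewrite <- Hk in H. apply Rmult_le_reg_r in H; lra. }
  destruct Hint as [Hq' Hs'].
  destruct (interior_min_critical q s k Hq' Hs' Hk Hle) as [H1 H2].
  exists k. split; [lra |]. split; [| exact Hle].
  now apply (critical_value_root q s).
Qed.

Lemma ratio_lower_bound :
  exists k, 60 <= k /\ poly_K k = 0 /\
    forall q s, 0 <= q <= 1/3 -> 0 <= s <= q/3 -> k * ratio_den q s <= ratio_num q s.
Proof.
  destruct ratio_min as (k & Hk & Hroot & Hmin). exists k.
  split; [lra |]. split; [exact Hroot |]. intros q s Hq Hs.
  destruct (excluded_middle_informative
    (24/100 < q < 275/1000 /\ 53/1000 < s < 68/1000)) as [H | H].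
  - apply Hmin; lra.
  - pose proof (ratio_ge_outside q s Hq Hs ltac:(tauto)) as Hup.
    assert (0 <= ratio_num q s).
    { apply Rmult_le_pos; [apply Rmult_le_pos; [lra | apply pow2_ge_0] |].
      (* Hence [(1 - q)^2 - 12 q s >= (1 - 3 q) (1 + q) >= 0]. *)
      assert (q * s <= q * (q / 3)) by (apply Rmult_le_compat_l; lra). nra. }
    (* Outside the rectangle [ratio_den] may be negative; the claim is then trivial. *)
    destruct (Rle_dec 0 (ratio_den q s)); nra.
Qed.

(** * The largest root and the bound for X_7 *)

(** Expanded around 60, the increment has nonnegative coefficients even after subtracting h, which
    makes it strict. *)
Lemma poly_K_increasing (k l : R) : 60 <= k -> k < l -> poly_K k < poly_K l.
Proof.
  intros Hk Hkl.
  assert (H : forall t h, 0 <= t -> 0 <= h ->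
    0 <= poly_K (60 + t + h) - poly_K (60 + t) - h).
  { intros t h Ht Hh. unfold poly_K.
    match goal with |- 0 <= ?e => ring_simplify e end. nonneg_poly. }
  specialize (H (k - 60) (l - k) ltac:(lra) ltac:(lra)).
  replace (60 + (k - 60) + (l - k)) with l in H by ring.
  replace (60 + (k - 60)) with k in H by ring. lra.
Qed.

Lemma poly_K_sq (x : R) : poly_K (x^2) = poly_C6 x.
Proof. unfold poly_K, poly_C6. ring. Qed.

Lemma sqrt_largest_root (k : R) :
  60 <= k -> poly_K k = 0 ->
  is_largest_root poly_C6 (sqrt k) /\
  Rabs (sqrt k - 78631112181 / 10^10) <= 5 / 10^11.
Proof.
  intros Hk Hroot.
  pose proof (sqrt_pos k) as Hc0. assert (Hc2 : (sqrt k)^2 = k) by (apply pow2_sqrt; lra).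
  set (c := sqrt k) in *. clearbody c.
  assert (Hsign : forall x, 0 <= x -> 60 <= x^2 ->
    (c < x -> 0 < poly_C6 x) /\ (x < c -> poly_C6 x < 0)).
  { intros x Hx0 Hx. rewrite <- poly_K_sq, <- Hroot.
    split; intros H; apply poly_K_increasing; try lra; nra. }
  split; [split |].
  - rewrite <- poly_K_sq, Hc2. exact Hroot.
  - intros x Hx. apply Rnot_lt_le. intros Hcx.
    destruct (Hsign x) as [H _]; [lra | nra |]. specialize (H Hcx). lra.
  - apply Rabs_le. split.
    (* The two test points differ from the stated decimal by half a unit in its last place. *)
    + destruct (Hsign (786311121805 / 10^11)) as [H _]; [lra | lra |].
      destruct (Rlt_dec c (786311121805 / 10^11)) as [Hlt | Hlt]; [| lra].
      specialize (H Hlt). exfalso. revert H. apply Rle_not_lt. unfold poly_C6. lra.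
    + destruct (Hsign (786311121815 / 10^11)) as [_ H]; [lra | lra |].
      destruct (Rlt_dec (786311121815 / 10^11) c) as [Hlt | Hlt]; [| lra].
      specialize (H Hlt). exfalso. revert H. apply Rle_not_lt. unfold poly_C6. lra.
Qed.

(** By homogeneity only [q / p^2] and [r / (p q)] matter; their ranges come from [3 q <= p^2] and
    [3 p r <= q^2]. *)
Lemma dist_7_3_le (A B C : point) (k : R) :
  nondegenerate A B C -> 0 < k ->
  (forall q s, 0 <= q <= 1/3 -> 0 <= s <= q/3 -> k * ratio_den q s <= ratio_num q s) ->
  sqrt k * center_dist A B C 6 7 <= center_dist A B C 6 3.
Proof.
  intros HABC Hk H.
  assert (Hc : 0 < sqrt k) by now apply sqrt_lt_R0.
  assert (Hc2 : (sqrt k)^2 = k) by (apply pow2_sqrt; lra).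
  enough (center_dist A B C 6 7 <= / sqrt k * center_dist A B C 6 3).
  { apply (Rmult_le_reg_l (/ sqrt k)); [now apply Rinv_0_lt_compat |].
    rewrite <- Rmult_assoc, Rinv_l, Rmult_1_l; lra. }
  apply center_dist_le; try assumption; try lia; [left; now apply Rinv_0_lt_compat |].
  intros x y z Hx Hy Hz p q r.
  assert (Hxy := Rmult_lt_0_compat _ _ Hx Hy).
  assert (Hyz := Rmult_lt_0_compat _ _ Hy Hz).
  assert (Hzx := Rmult_lt_0_compat _ _ Hz Hx).
  assert (Hr : 0 < r) by (apply Rmult_lt_0_compat; lra).
  assert (Hp : 0 < p) by (unfold p; lra).
  assert (Hq : 0 < q) by (unfold q; lra).
  assert (Hpq : 3 * q <= p^2).
  { pose proof (pow2_ge_0 (x - y)). pose proof (pow2_ge_0 (y - z)).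
    pose proof (pow2_ge_0 (z - x)). unfold p, q. lra. }
  assert (Hqr : 3 * (p * r) <= q^2).
  { pose proof (pow2_ge_0 (x * y - y * z)). pose proof (pow2_ge_0 (y * z - z * x)).
    pose proof (pow2_ge_0 (z * x - x * y)). unfold p, q, r. lra. }
  clearbody p q r. clear x y z Hx Hy Hz Hxy Hyz Hzx.
  assert (Hp2 : 0 < p^2) by now apply pow_lt.
  assert (Hpq0 : 0 < p * q) by now apply Rmult_lt_0_compat.
  specialize (H (q / p^2) (r / (p * q))).
  assert (H1 : 0 <= q / p^2 <= 1/3).
  { split; [left; now apply Rdiv_lt_0_compat |].
    apply (Rmult_le_reg_r (p^2)); [assumption |]. field_simplify; lra. }
  assert (H2 : 0 <= r / (p * q) <= q / p^2 / 3).
  { split; [left; now apply Rdiv_lt_0_compat |].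
    apply (Rmult_le_reg_r (3 * p * (p * q))); [apply Rmult_lt_0_compat; lra |].
    replace (r / (p * q) * (3 * p * (p * q))) with (3 * (p * r)) by (field; lra).
    replace (q / p^2 / 3 * (3 * p * (p * q))) with (q^2) by (field; lra).
    assumption. }
  specialize (H H1 H2). clear H1 H2.
  assert (E3 : dist_num 3 p q r * dist_den 7 p q r
               = p^8 * q^3 * ratio_num (q / p^2) (r / (p * q))).
  { unfold dist_num, dist_den, ratio_num.
    cbn [dist_num_coef dist_den_coef dist_den_has_r]. field. lra. }
  assert (E7 : dist_num 7 p q r * dist_den 3 p q r
               = p^8 * q^3 * ratio_den (q / p^2) (r / (p * q))).
  { unfold dist_num, dist_den, ratio_den.
    cbn [dist_num_coef dist_den_coef dist_den_has_r]. field. lra. }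
  rewrite E3, E7, pow_inv, Hc2. clear E3 E7.
  apply (Rmult_le_reg_l k); [assumption |].
  rewrite <- (Rmult_assoc k (/ k)), Rinv_r, Rmult_1_l by lra.
  replace (k * (p^8 * q^3 * ratio_den (q / p^2) (r / (p * q))))
    with (p^8 * q^3 * (k * ratio_den (q / p^2) (r / (p * q)))) by ring.
  apply Rmult_le_compat_l; [| exact H].
  apply Rmult_le_pos; apply pow_le; lra.
Qed.

(** * The complete list of bounds *)

Theorem theorem6 :
  exists C6 : R,
    is_largest_root poly_C6 C6 /\
    Rabs (C6 - 78631112181 / 10^10) <= 5 / 10^11 /\
    forall A B C : point, nondegenerate A B C ->
      let D := center_dist A B C in
      D 6%nat 1%nat <= (9 - 6 * sqrt 2) * D 6%nat 2%nat /\
      D 6%nat 1%nat <= (2 - sqrt 3) * D 6%nat 3%nat /\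
      1 / 2 * D 6%nat 7%nat <= D 6%nat 1%nat /\
      D 6%nat 1%nat <= (2 * sqrt 2 - 1) / 7 * D 6%nat 8%nat /\
      D 6%nat 1%nat <= 1 / 3 * D 6%nat 9%nat /\
      D 6%nat 1%nat <= (sqrt 2 - 1) * D 6%nat 10%nat /\

      D 6%nat 2%nat <= 2 / 3 * D 6%nat 3%nat /\
      1 * D 6%nat 7%nat <= D 6%nat 2%nat /\
      1 / 3 * D 6%nat 8%nat <= D 6%nat 2%nat
        <= (5 + 4 * sqrt 2) / 21 * D 6%nat 8%nat /\
      1 / 2 * D 6%nat 9%nat <= D 6%nat 2%nat <= 3 / 4 * D 6%nat 9%nat /\
      2 / 3 * D 6%nat 10%nat <= D 6%nat 2%nat
        <= (1 + sqrt 2) / 3 * D 6%nat 10%nat /\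

      1 / 2 * D 6%nat 4%nat <= D 6%nat 3%nat /\
      2 * D 6%nat 5%nat <= D 6%nat 3%nat /\
      C6 * D 6%nat 7%nat <= D 6%nat 3%nat /\
      1 / 2 * D 6%nat 8%nat <= D 6%nat 3%nat /\
      1 * D 6%nat 9%nat <= D 6%nat 3%nat /\
      1 * D 6%nat 10%nat <= D 6%nat 3%nat /\

      D 6%nat 7%nat <= 1 / 2 * D 6%nat 8%nat /\
      D 6%nat 7%nat <= 1 / 2 * D 6%nat 9%nat /\
      D 6%nat 7%nat <= 4 / 5 * D 6%nat 10%nat /\
      1 * D 6%nat 9%nat <= D 6%nat 8%nat <= 2 * D 6%nat 9%nat /\
      (3 - sqrt 2) * D 6%nat 10%nat <= D 6%nat 8%nat <= 2 * D 6%nat 10%nat /\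
      1 * D 6%nat 10%nat <= D 6%nat 9%nat <= 8 / 5 * D 6%nat 10%nat.
Proof.
  destruct ratio_lower_bound as (k & Hk & Hroot & Hmin).
  destruct (sqrt_largest_root k Hk Hroot) as [Hlargest Hbound].
  exists (sqrt k). split; [exact Hlargest |]. split; [exact Hbound |].
  intros A B C HABC D.
  pose proof (dist_1_2_le A B C HABC) as H1_2.
  pose proof (dist_1_3_le A B C HABC) as H1_3.
  pose proof (dist_7_3_le A B C k HABC ltac:(lra) Hmin) as H7_3.
  destruct (nagel_line_le A B C HABC) as (H1_8 & H1_10 & H2_8 & H2_10 & H10_8).
  fold D in H1_2, H1_3, H7_3, H1_8, H1_10, H2_8, H2_10, H10_8.
  (* Lower bounds on a quotient are proved as upper bounds on its inverse. *)
  assert (D_7_1 : D 6%nat 7%nat <= 2 * D 6%nat 1%nat)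
    by dist_le 7%nat 1%nat 2 4 1.
  assert (D_1_9 : D 6%nat 1%nat <= 1/3 * D 6%nat 9%nat)
    by dist_le 1%nat 9%nat (1/3) 1 9.
  assert (D_7_2 : D 6%nat 7%nat <= 1 * D 6%nat 2%nat)
    by dist_le 7%nat 2%nat 1 1 1.
  assert (D_8_2 : D 6%nat 8%nat <= 3 * D 6%nat 2%nat)
    by dist_le 8%nat 2%nat 3 9 1.
  assert (D_9_2 : D 6%nat 9%nat <= 2 * D 6%nat 2%nat)
    by dist_le 9%nat 2%nat 2 4 1.
  assert (D_2_9 : D 6%nat 2%nat <= 3/4 * D 6%nat 9%nat)
    by dist_le 2%nat 9%nat (3/4) 9 16.
  assert (D_10_2 : D 6%nat 10%nat <= 3/2 * D 6%nat 2%nat)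
    by dist_le 10%nat 2%nat (3/2) 9 4.
  assert (D_4_3 : D 6%nat 4%nat <= 2 * D 6%nat 3%nat)
    by dist_le 4%nat 3%nat 2 4 1.
  assert (D_5_3 : D 6%nat 5%nat <= 1/2 * D 6%nat 3%nat)
    by dist_le 5%nat 3%nat (1/2) 1 4.
  assert (D_7_8 : D 6%nat 7%nat <= 1/2 * D 6%nat 8%nat)
    by dist_le 7%nat 8%nat (1/2) 1 4.
  assert (D_7_9 : D 6%nat 7%nat <= 1/2 * D 6%nat 9%nat)
    by dist_le 7%nat 9%nat (1/2) 1 4.
  assert (D_7_10 : D 6%nat 7%nat <= 4/5 * D 6%nat 10%nat)
    by dist_le 7%nat 10%nat (4/5) 16 25.
  assert (D_9_8 : D 6%nat 9%nat <= 1 * D 6%nat 8%nat)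
    by dist_le 9%nat 8%nat 1 1 1.
  assert (D_8_9 : D 6%nat 8%nat <= 2 * D 6%nat 9%nat)
    by dist_le 8%nat 9%nat 2 4 1.
  assert (D_8_10 : D 6%nat 8%nat <= 2 * D 6%nat 10%nat)
    by dist_le 8%nat 10%nat 2 4 1.
  assert (D_10_9 : D 6%nat 10%nat <= 1 * D 6%nat 9%nat)
    by dist_le 10%nat 9%nat 1 1 1.
  assert (D_9_10 : D 6%nat 9%nat <= 8/5 * D 6%nat 10%nat)
    by dist_le 9%nat 10%nat (8/5) 64 25.
  assert (D_2_3 : D 6%nat 2%nat <= 2/3 * D 6%nat 3%nat)
    by dist_le3 2%nat (2/3) 4 9.
  assert (D_8_3 : D 6%nat 8%nat <= 2 * D 6%nat 3%nat)
    by dist_le3 8%nat 2 4 1.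
  assert (D_9_3 : D 6%nat 9%nat <= 1 * D 6%nat 3%nat)
    by dist_le3 9%nat 1 1 1.
  assert (D_10_3 : D 6%nat 10%nat <= 1 * D 6%nat 3%nat)
    by dist_le3 10%nat 1 1 1.
  clearbody D. repeat split; try assumption; lra.
Qed.
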